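(* Let $G$ be a countable sofic group with sofic approximation $\Sigma=(\sigma_n:G\to\mathrm{Sym}(V_n))_{n\ge 1}$. Let $(\mathcal{X}^G,\mu,S,d)$ be a metric $G$-process and let $\mathfrak{P}$ be any family of finite Borel partitions of $\mathcal{X}$ having the following two properties: (Pi) for every $\delta>0$ there exists $\mathcal{P}\in\mathfrak{P}$ all of whose cells have $d$-diameter less than $\delta$; (Pii) if $\mathcal{P}\in\mathfrak{P}$ then every cell $C\in\mathcal{P}$ satisfies $\mu\{x\in\mathcal{X}^G:x_e\in\partial C\}=0$, where $e$ is the identity of $G$. Then $$\mathrm{h}^{\mathrm{m}}_\Sigma(\mu)=\sup\Big\{\limsup_{i\to\infty}\frac{1}{|V_{n_i}|}\log\mathrm{cov}_\varepsilon(\mu_i;\mathcal{P}^{V_{n_i}}):\ \varepsilon>0,\ \mathcal{P}\in\mathfrak{P},\ n_i\uparrow\infty,\ \mu_i\stackrel{\mathrm{lde}}{\longrightarrow}\mu\ \text{over}\ (\sigma_{n_i})_{i\ge1}\Big\}$$ $$=\sup\Big\{\limsup_{i\to\infty}\frac{1}{|V_{n_i}|}\mathrm{H}_{\mu_i}(\mathcal{P}^{V_{n_i}}):\ \mathcal{P}\in\mathfrak{P},\ n_i\uparrow\infty,\ \mu_i\stackrel{\mathrm{lde}}{\longrightarrow}\mu\ \text{over}\ (\sigma_{n_i})_{i\ge1}\Big\}.$$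
   Context: A sofic approximation to $G$ is a sequence of maps $\sigma_n:G\to\mathrm{Sym}(V_n)$, $g\mapsto\sigma_n^g$, with $V_n$ finite nonempty sets, such that $|\{v\in V_n:\sigma_n^g(\sigma_n^h(v))=\sigma_n^{gh}(v)\}|=(1-o(1))|V_n|$ for all $g,h\in G$ and $|\{v\in V_n:\sigma_n^g(v)\ne v\}|=(1-o(1))|V_n|$ for all $g\in G\setminus\{e\}$. A metric $G$-process $(\mathcal{X}^G,\mu,S,d)$ consists of a standard measurable space $\mathcal{X}$, a compact metric $d$ on $\mathcal{X}$ whose Borel sets are the measurable sets of $\mathcal{X}$, the left coordinate-shift action $S$ of $G$ on $\mathcal{X}^G$ (with the convention $(S^gx)_h=x_{hg}$, compatible with the pullback names below), and an $S$-invariant Borel probability measure $\mu$ on $\mathcal{X}^G$. $\mathrm{Prob}(Y)$ denotes the Borel probability measures on $Y$; $\mathrm{Prob}(\mathcal{X}^G)$ carries the weak$^\ast$ topology coming from the product topology on $\mathcal{X}^G$. For $\mathbf{x}\in\mathcal{X}^{V_n}$ and $v\in V_n$ the pullback name is $\Pi^{\sigma_n}_v(\mathbf{x})=(x_{\sigma_n^g(v)})_{g\in G}\in\mathcal{X}^G$, and the empirical distribution is $P^{\sigma_n}_{\mathbf{x}}=\frac{1}{|V_n|}\sum_{v\in V_n}\delta_{\Pi_v^{\sigma_n}(\mathbf{x})}$. For $U\subseteq\mathrm{Prob}(\mathcal{X}^G)$ let $\Omega(U,\sigma_n)=\{\mathbf{x}\in\mathcal{X}^{V_n}:P^{\sigma_n}_{\mathbf{x}}\in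 U\}$. For $\mu_n\in\mathrm{Prob}(\mathcal{X}^{V_n})$: local weak$^\ast$ convergence $\mu_n\stackrel{\mathrm{lw}\ast}{\longrightarrow}\mu$ over $\Sigma$ means $|\{v\in V_n:(\Pi_v^{\sigma_n})_\ast\mu_n\in U\}|=(1-o(1))|V_n|$ for every weak$^\ast$ neighbourhood $U$ of $\mu$. LE-convergence $\mu_n\stackrel{\mathrm{le}}{\longrightarrow}\mu$ means $\mu_n\stackrel{\mathrm{lw}\ast}{\longrightarrow}\mu$ and $\mu_n(\Omega(U,\sigma_n))\to1$ for every weak$^\ast$ neighbourhood $U$ of $\mu$. LDE convergence $\mu_n\stackrel{\mathrm{lde}}{\longrightarrow}\mu$ means $\mu_n\times\mu_n\stackrel{\mathrm{le}}{\longrightarrow}\mu\times\mu$ over $\Sigma$, where $\mathcal{X}^{V_n}\times\mathcal{X}^{V_n}=(\mathcal{X}\times\mathcal{X})^{V_n}$ and $\mathcal{X}^G\times\mathcal{X}^G=(\mathcal{X}\times\mathcal{X})^G$. The same definitions apply to $\mu_i\in\mathrm{Prob}(\mathcal{X}^{V_{n_i}})$ over a subsequence $(\sigma_{n_i})_{i\ge1}$, $n_1<n_2<\cdots$. On $\mathcal{X}^{V}$, $V$ finite, $d^{(V)}(\mathbf{x},\mathbf{y})=\frac{1}{|V|}\sum_{v\in V}d(x_v,y_v)$. For $\nu\in\mathrm{Prob}(\mathcal{X}^V)$, $\mathrm{cov}_{\varepsilon,\delta}(\nu,d^{(V)})$ is the least number of $\delta$-balls in $d^{(V)}$ whose union has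 $\nu$-measure more than $1-\varepsilon$. The model-measure sofic entropy is $$\mathrm{h}^{\mathrm{m}}_\Sigma(\mu)=\sup\Big\{\sup_{\delta,\varepsilon>0}\limsup_{i\to\infty}\frac{1}{|V_{n_i}|}\log\mathrm{cov}_{\varepsilon,\delta}(\mu_i,d^{(V_{n_i})}):\ n_i\uparrow\infty,\ \mu_i\stackrel{\mathrm{lde}}{\longrightarrow}\mu\ \text{over}\ (\sigma_{n_i})_{i\ge1}\Big\}.$$ Convention: $\sup\emptyset=-\infty$. $\mathcal{P}^{V}$ is the partition of $\mathcal{X}^{V}$ into products of cells of $\mathcal{P}$. For a probability measure $\nu$ on a space with finite measurable partition $\mathcal{R}$ and $\varepsilon>0$, $\mathrm{cov}_\varepsilon(\nu;\mathcal{R})=\min\{|\mathcal{R}_1|:\mathcal{R}_1\subseteq\mathcal{R},\ \nu(\bigcup\mathcal{R}_1)>1-\varepsilon\}$, and $\mathrm{H}_\nu(\mathcal{R})=-\sum_{C\in\mathcal{R}}\nu(C)\log\nu(C)$ is Shannon entropy. *)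

(* Defs.v *)
From HB Require Import structures.
From mathcomp Require Import all_boot all_order all_algebra all_fingroup.
From mathcomp Require Import finmap.
From mathcomp Require Import all_classical all_reals all_analysis.

Set Implicit Arguments.
Unset Strict Implicit.
Unset Printing Implicit Defensive.

Import Order.TTheory GRing.Theory Num.Theory.
Import numFieldNormedType.Exports.

Local Open Scope classical_set_scope.
Local Open Scope ring_scope.

(* No compatibility between the topology and the sigma-algebra is built into
   these two structures; that the sigma-algebra is the Borel one has to be
   assumed separately. *)
#[short(type="topMeasurableType")]
HB.structure Definition TopMeasurable d :=
  {T of Topological T & Measurable d T}.

#[short(type="metricMeasurableType")]
HB.structure Definition MetricMeasurable (R : numDomainType) d :=
  {T of Metric R T & Measurable d T}.

HB.saturate prod.

(* X^I with the product topology and the product sigma-algebra.  For I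
   countable and X second countable with its Borel sigma-algebra, the latter is
   the Borel sigma-algebra of the former. *)
Definition config (I X : Type) : Type := I -> X.

Section config_structures.
Context (I : Type) d (X : topMeasurableType d).

HB.instance Definition _ := Pointed.copy (config I X) (I -> X).

HB.instance Definition _ :=
  Topological.copy (config I X) (prod_topology (fun _ : I => X)).

Definition config_measurable : set (set (config I X)) :=
  <<s \bigcup_(i in [set: I])
        preimage_set_system setT (fun x : config I X => x i) measurable >>.

Definition config_display : measure_display. Proof. by constructor. Qed.

HB.instance Definition _ := @isMeasurable.Build config_display (config I X)
  config_measurable (@sigma_algebra0 _ setT _) (@sigma_algebraC _ _)
  (@sigma_algebra_bigcup _ setT _).

Lemma measurable_coord (i : I) :
  measurable_fun [set: config I X] (fun x : config I X => x i).
Proof.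
move=> _ B mB; rewrite setTI; apply: sub_gen_smallest.
by exists i => //; exists B => //; rewrite setTI.
Qed.

Lemma measurable_config d' (T : measurableType d') (f : T -> config I X) :
  (forall i, measurable_fun setT (fun t => f t i)) -> measurable_fun setT f.
Proof.
move=> mf; apply: (measurability _ (erefl config_measurable)).
move=> _ [_ [i _ [B mB <-]] <-]; rewrite !setTI.
by have := mf i measurableT B mB; rewrite setTI.
Qed.

End config_structures.

Section weak_star.
Context d (T : topMeasurableType d) (R : realType).

Definition Prob : Type := probability T R.

HB.instance Definition _ := gen_eqMixin Prob.
HB.instance Definition _ := gen_choiceMixin Prob.

Definition Prob_eval (mu : Prob) : {ptws (continuousType T R) -> R} :=
  fun f => \int[mu]_x f x.

(* Prob(T), T compact, with the weak* topology: the coarsest one making all the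
   maps mu |-> \int f dmu, f continuous, continuous. *)
Definition wstar := initial_topology Prob_eval.

HB.instance Definition _ := Topological.on wstar.

End weak_star.

Section sofic.
Context (G : groupType) (R : realType).

Definition sofic_approximation (V : nat -> finType)
    (sigma : forall n, G -> {perm V n}) : Prop :=
  (forall g h : G,
     (#|[pred v : V n | sigma n g (sigma n h v) == sigma n (g * h)%g v]|%:R
       / #|V n|%:R : R) @[n --> \oo] --> (1 : R)) /\
  (forall g : G, g != 1%g ->
     (#|[pred v : V n | sigma n g v != v]|%:R / #|V n|%:R : R)
       @[n --> \oo] --> (1 : R)).

End sofic.

Section shift.
Context (G : groupType) d (X : topMeasurableType d) (R : realType).

Definition coord_shift (g : G) (x : config G X) : config G X :=
  fun h => x (h * g)%g.

Definition shift_invariant (mu : Prob (config G X) R) : Prop :=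
  forall (g : G) (A : set (config G X)), measurable A ->
    mu (coord_shift g @^-1` A) = mu A.

End shift.

Section pullback.
Context (G : groupType) d (X : topMeasurableType d) (R : realType).
Context (V : finType) (sigma : G -> {perm V}).

Definition pullback (v : V) (x : config V X) : config G X :=
  fun g => x (sigma g v).

Lemma measurable_pullback v : measurable_fun setT (pullback v).
Proof. by apply: measurable_config => g; exact: measurable_coord. Qed.

HB.instance Definition _ v :=
  isMeasurableFun.Build _ _ _ _ (pullback v) (measurable_pullback v).

(* The nonemptiness proof only serves to make this a probability measure. *)
Definition empirical (V_gt0 : (0 < #|V|)%N) (x : config V X)
    (A : set (config G X)) : \bar R :=
  ((#|V|%:R^-1)%:E * \sum_(v : V) \d_(pullback v x) A)%E.

Section empirical_probability.
Variables (V_gt0 : (0 < #|V|)%N) (x : config V X).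

Let empirical0 : empirical V_gt0 x set0 = 0%E.
Proof. by rewrite /empirical big1 ?mule0. Qed.

Let empirical_ge0 A : (0 <= empirical V_gt0 x A)%E.
Proof.
apply: mule_ge0; first by rewrite lee_fin invr_ge0 ler0n.
by apply: sume_ge0 => v _; exact: measure_ge0.
Qed.

Let empirical_sigma_additive : semi_sigma_additive (empirical V_gt0 x).
Proof.
pose r : {nonneg R} := NngNum (ltac:(by rewrite invr_ge0 ler0n) : 0 <= #|V|%:R^-1).
pose v0 : V := enum_val (Ordinal V_gt0).
pose m (k : nat) : {measure set (config G X) -> \bar R} :=
  \d_(pullback (nth v0 (enum V) k) x).
have -> : empirical V_gt0 x = mscale r (msum m #|V|).
  apply/funext => A; rewrite /empirical /mscale/= /msum; congr (_ * _)%E.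
  by rewrite -[LHS]big_enum/= (big_nth v0) -cardE big_mkord.
exact: measure_semi_sigma_additive.
Qed.

HB.instance Definition _ := isMeasure.Build _ _ _ (empirical V_gt0 x)
  empirical0 empirical_ge0 empirical_sigma_additive.

Let empirical_setT : empirical V_gt0 x setT = 1%E.
Proof.
rewrite /empirical (eq_bigr (fun=> 1%E)); last by move=> v _; rewrite diracT.
rewrite sumEFin sumr_const -EFinM mulVf// pnatr_eq0.
by rewrite -lt0n.
Qed.

HB.instance Definition _ := Measure_isProbability.Build _ _ _
  (empirical V_gt0 x) empirical_setT.

End empirical_probability.

Definition Omega (V_gt0 : (0 < #|V|)%N) (U : set (wstar (config G X) R)) :
    set (config V X) :=
  [set x | U (empirical V_gt0 x : probability _ R)].

End pullback.

Section square.
Context (I : Type) d (X : topMeasurableType d) (R : realType).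

Definition config_pair (z : config I X * config I X) : config I (X * X)%type :=
  fun i => (z.1 i, z.2 i).

Lemma measurable_config_pair : measurable_fun setT config_pair.
Proof.
apply: measurable_config => i; apply/measurable_fun_pairP; split.
- exact: (measurableT_comp (@measurable_coord _ _ _ i) measurable_fst).
- exact: (measurableT_comp (@measurable_coord _ _ _ i) measurable_snd).
Qed.

HB.instance Definition _ :=
  isMeasurableFun.Build _ _ _ _ config_pair measurable_config_pair.

(* mu \x mu transported to (X * X)^I *)
Definition square (mu : Prob (config I X) R) : Prob (config I (X * X)%type) R :=
  distribution (mu \x mu)%E config_pair.

End square.

Section convergence.
Context (G : groupType) (R : realType).
Context (V : nat -> finType) (V_gt0 : forall n, (0 < #|V n|)%N).
Context (sigma : forall n, G -> {perm V n}).

Section convergence_to.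
Context d (X : topMeasurableType d).
Implicit Types (mus : forall n, Prob (config (V n) X) R).
Implicit Types (mu : Prob (config G X) R).

Definition lw_cvg mus mu : Prop :=
  forall U : set (wstar (config G X) R), open_nbhs (mu : wstar _ R) U ->
    (#|[pred v | `[< U (distribution (mus n) (pullback (sigma n) v)) >]]|%:R
      / #|V n|%:R : R) @[n --> \oo] --> (1 : R).

(* Open neighbourhoods only: for these Omega(U) is open, hence measurable. *)
Definition le_cvg mus mu : Prop :=
  lw_cvg mus mu /\
  forall U : set (wstar (config G X) R), open_nbhs (mu : wstar _ R) U ->
    mus n (Omega (sigma n) (V_gt0 n) U) @[n --> \oo] --> 1%E.

End convergence_to.

Definition lde_cvg d (X : topMeasurableType d)
    (mus : forall n, Prob (config (V n) X) R) (mu : Prob (config G X) R) :=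
  le_cvg (fun n => square (mus n)) (square mu).

End convergence.

Section covering.
Context (V : finType) (R : realType) d (X : metricMeasurableType R d).

Definition config_dist (x y : config V X) : R :=
  #|V|%:R^-1 * \sum_(v : V) mdist (x v) (y v).

(* +oo if there is no such family of balls *)
Definition cov_metric (eps delta : R) (nu : Prob (config V X) R) : \bar R :=
  ereal_inf [set (size s)%:R%:E | s in [set s : seq (config V X) |
    ((1 - eps)%:E <
      nu (\bigcup_(c in [set` s]) [set y | (config_dist c y < delta)%R]))%E]].

End covering.

Section partitions.
Context (R : realType).

Definition finite_measurable_partition d (T : measurableType d)
    (P : set (set T)) : Prop :=
  [/\ finite_set P, partition P id [set: T] & P `<=` measurable].

Definition power_partition (V X : Type) (P : set (set X)) :
    set (set (config V X)) :=
  [set [set x | forall v, F v (x v)] | F in [set F | forall v, P (F v)]].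

Definition cov_partition d (T : measurableType d) (eps : R)
    (nu : probability T R) (Q : set (set T)) : \bar R :=
  ereal_inf [set (#|` Q1|)%:R%:E | Q1 in [set Q1 : {fset (set T)} |
    [set` Q1] `<=` Q /\
    ((1 - eps)%:E < nu (\bigcup_(C in [set` Q1]) C))%E]].

(* Q is meant to be finite; ln 0 = 0 gives the convention 0 log 0 = 0. *)
Definition shannon_entropy d (T : measurableType d)
    (nu : probability T R) (Q : set (set T)) : R :=
  - \sum_(C \in Q) fine (nu C) * ln (fine (nu C)).

End partitions.
Arguments power_partition V {X} P.

Section metric_notions.
Context (R : realType) d (X : metricMeasurableType R d).

Definition diam (C : set X) : \bar R :=
  ereal_sup [set (mdist z.1 z.2)%:E | z in C `*` C].

Definition boundary (C : set X) : set X := closure C `\` C°.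

End metric_notions.

Section model_measure_entropy.
Context (G : groupType) (R : realType).
Context (V : nat -> finType) (V_gt0 : forall n, (0 < #|V n|)%N).
Context (sigma : forall n, G -> {perm V n}).
Context d (X : metricMeasurableType R d).

Definition lde_subsequence (mu : Prob (config G X) R) (ni : nat -> nat)
    (mus : forall i, Prob (config (V (ni i)) X) R) : Prop :=
  {homo ni : i j / (i < j)%N} /\
  lde_cvg (fun i => V_gt0 (ni i)) (fun i => sigma (ni i)) mus mu.

Definition model_measure_entropy (mu : Prob (config G X) R) : \bar R :=
  ereal_sup [set h : \bar R |
    exists (ni : nat -> nat) (mus : forall i, Prob (config (V (ni i)) X) R),
      lde_subsequence mu mus /\
      h = ereal_sup [set h' : \bar R | exists eps delta : R,
        [/\ 0 < eps, 0 < delta &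
          h' = limn_esup (fun i => ((#|V (ni i)|%:R^-1)%:E *
                 lne (cov_metric eps delta (mus i)))%E)]]].

End model_measure_entropy.

(* Main.v *)
Require Import Defs.
From HB Require Import structures.
From mathcomp Require Import all_boot all_order all_algebra all_fingroup.
From mathcomp Require Import finmap.
From mathcomp Require Import all_classical all_reals all_analysis.
From mathcomp Require Import measurable_realfun ring lra.
Set Implicit Arguments.
Unset Strict Implicit.
Unset Printing Implicit Defensive.
Import Order.TTheory GRing.Theory Num.Theory.
Import numFieldNormedType.Exports.
Local Open Scope classical_set_scope.
Local Open Scope ring_scope.

(** Write V for the size of the vertex set, P^V for the partition of the
    configurations into products of cells of P, and mu_1 for the law of one
    coordinate under mu.  Three suprema over sequences mu_i converging to mu in
    the locally and doubly empirical (lde) sense are shown to agree: those of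
    the exponential growth rates of metric covering numbers, of covering numbers
    by cells of P^V, and of the entropies of P^V.

    Metric covers and covers by cells.  If all cells of P have diameter less
    than delta, one point per cell turns a cover by cells into a cover by
    delta-balls ([cov_metric_le_partition]).  Conversely let [inradius] be the
    distance from a point to the complement of its own cell; it is continuous,
    and by the boundary hypothesis it is positive mu_1-almost everywhere.  As
    empirical measures converge, with high probability few vertices carry a
    point of small inradius ([bump_law]).  Two such configurations in a common
    small ball have names (families of cells, indexed by the vertices) that
    differ at few vertices, so the names of such configurations in one ball lie
    in a Hamming ball of subexponential size ([hamming_ball_card]);
    this is [cov_partition_metric].

    Entropy is at most the covering rate.  Gibbs' inequality bounds the entropy
    by the logarithm of the number of cells of a cover of mass 1 - e, up to an
    error per vertex that vanishes with e ([entropy_cover], [entropy_error],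
    [entropy_le_cov]).

    The covering rate is at most the entropy supremum.  A single measure mu_i
    may have an entropy much smaller than the logarithm of its covering number,
    so the measure is changed: if h is less than the covering rate, the words of
    mass less than exp (- h V) have total mass at least eps infinitely often,
    and conditioning mu_i on them gives entropy at least h V + ln eps
    ([cov_le_entropy_diverge]).  This is admissible because lde convergence
    survives conditioning on events of mass bounded below ([lde_dominated]).
    The reason is a second moment: for a continuous f of mean 0 under mu, the
    average over vertices v of the square of the conditional mean of f at v is
    the mean, over two independent configurations, of an empirical average of
    f (x) f (y), and double convergence makes the latter small with high
    probability.

    The term ln eps is negligible only when V tends to infinity.  If two cells
    have positive mu_1-measure, two independent configurations eventually have
    different names with probability close to 1, which forces V to diverge
    ([two_cells_diverge]).  Otherwise one cell has full measure and the covering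
    rate is at most 0 ([cov_partition_full_cell]).  Both cases are assembled in
    [cov_le_entropy]. *)

(** * Continuity and measurability on configuration spaces *)

Lemma cvg_initial (S : choiceType) (T : topologicalType) (f : S -> T)
    (F : set_system S) (s : S) : Filter F ->
  f @ F --> f s -> F --> (s : initial_topology f).
Proof.
move=> FF fFs A; rewrite nbhsE => -[B [[C oC <-] Cfs] BA].
apply: filterS BA _; apply: fFs.
by rewrite nbhsE; exists C.
Qed.

Lemma cvg_prod_topology (I : Type) (T : I -> topologicalType)
    (F : set_system (prod_topology T)) (t : prod_topology T) : Filter F ->
  (forall i, (fun x : prod_topology T => x i) @ F --> t i) -> F --> t.
Proof.
by move=> FF Ft; apply/cvg_sup => i; apply: cvg_initial; exact: Ft.
Qed.

Section real_continuous.
Context (T : topologicalType) (R : realType).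
Implicit Types f g : T -> R.

Lemma continuous_constr (r : R) : continuous (fun _ : T => r).
Proof. by move=> x; exact: cvg_cst. Qed.

Lemma continuous_addr f g : continuous f -> continuous g ->
  continuous (fun x => f x + g x).
Proof. by move=> cf cg x; apply: cvgD; [exact: cf|exact: cg]. Qed.

Lemma continuous_subr f g : continuous f -> continuous g ->
  continuous (fun x => f x - g x).
Proof. by move=> cf cg x; apply: cvgB; [exact: cf|exact: cg]. Qed.

Lemma continuous_mulr f g : continuous f -> continuous g ->
  continuous (fun x => f x * g x).
Proof. by move=> cf cg x; apply: cvgM; [exact: cf|exact: cg]. Qed.

Lemma continuous_normr f : continuous f -> continuous (fun x => `|f x|).
Proof. by move=> cf x; apply: cvg_norm; exact: cf. Qed.

Lemma continuous_sumr (I : finType) (f : I -> T -> R) :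
  (forall i, continuous (f i)) -> continuous (fun x => \sum_i f i x).
Proof. by move=> cf; apply: continuous_big => // z; exact: add_continuous. Qed.

Lemma continuous_compr (U : topologicalType) (h : U -> T) f :
  continuous h -> continuous f -> continuous (fun x => f (h x)).
Proof. by move=> ch cf x; apply: continuous_comp; [exact: ch|exact: cf]. Qed.

End real_continuous.

Lemma config_cvg (I : Type) d (X : topMeasurableType d)
    (F : set_system (config I X)) (t : config I X) : Filter F ->
  (forall i, (fun x : config I X => x i) @ F --> t i) -> F --> t.
Proof. by move=> FF Ft; apply: (@cvg_prod_topology I (fun=> X)). Qed.

Lemma config_coord_continuous (I : Type) d (X : topMeasurableType d) (i : I) :
  continuous (fun x : config I X => x i).
Proof.
move=> x; exact: (@proj_continuous {classic I} (fun=> X : topologicalType) i x).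
Qed.

Lemma config_compact (I : Type) d (X : topMeasurableType d) :
  compact [set: X] -> compact [set: config I X].
Proof.
move=> cX.
have := @tychonoff {classic I} (fun=> X) (fun=> setT) (fun=> cX).
by congr compact; apply/seteqP.
Qed.

(** Second countability together with measurability of the basic sets.  It makes
    open sets measurable, and it passes to products and to countable powers,
    whose sigma-algebras are not defined from their topologies. *)
Definition measurable_base d (X : topMeasurableType d) : Prop :=
  exists2 B : nat -> set X, (forall n, measurable (B n)) &
    forall x A, nbhs x A -> exists2 n, B n x & B n `<=` A.

Lemma measurable_base_count (I : countType) d (X : topMeasurableType d)
    (B : I -> set X) : (forall i, measurable (B i)) ->
  (forall x A, nbhs x A -> exists2 i, B i x & B i `<=` A) ->
  measurable_base X.
Proof.
move=> mB Bx; exists (fun n => if @choice.unpickle I n is Some i then B i else set0).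
  by move=> n; case: choice.unpickle.
move=> x A /Bx[i Bix BiA]; exists (choice.pickle i); rewrite (@choice.pickleK I)//.
Qed.

Lemma measurable_base_open d (X : topMeasurableType d) :
  measurable_base X -> forall U : set X, open U -> measurable U.
Proof.
move=> [B mB Bx] U oU.
have -> : U = \bigcup_n (if pselect (B n `<=` U) then B n else set0).
  apply/seteqP; split => [x Ux|x [n _]]; last by case: pselect => // h; exact: h.
  have [n Bnx BnU] := Bx x U (open_nbhs_nbhs (conj oU Ux)).
  by exists n => //; case: pselect.
by apply: bigcupT_measurable => n; case: pselect => ?; [exact: mB|exact: measurable0].
Qed.

Lemma compact_measurable_base (R : realType) d (X : metricMeasurableType R d) :
  compact [set: X] -> @measurable d X = <<s @open X >> -> measurable_base X.
Proof.
move=> /(@compact_second_countable R X) [B /countable_injP[f finj] [oB Bx]] bX.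
exists (fun n => \bigcup_(b in [set b | B b /\ f b = n]) b) => [n|x A /Bx].
  rewrite bX; apply: sub_gen_smallest; apply: bigcup_open => b [Bb _].
  exact: oB.
move=> [U [BU Ux] UA]; exists (f U); first by exists U.
move=> y [b [Bb fbU] yb]; apply: UA.
by rewrite -(finj b U)// inE.
Qed.

Lemma prod_measurable_base d1 d2 (X : topMeasurableType d1)
    (Y : topMeasurableType d2) :
  measurable_base X -> measurable_base Y -> measurable_base (X * Y)%type.
Proof.
move=> [B mB Bx] [C mC Cy].
apply: (@measurable_base_count (nat * nat)%type _ _
  (fun ij => B ij.1 `*` C ij.2)) => [ij|[x y] A [[P Q] [/= Px Qy] PQA]].
  exact: measurableX.
have [i Bix BiP] := Bx _ _ Px; have [j Cjy CjQ] := Cy _ _ Qy.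
exists (i, j) => //= -[a b] [/= Ba Cb]; apply: PQA; split => /=.
- exact: BiP.
- exact: CjQ.
Qed.

(** The basic sets are the finite intersections of cylinders, indexed by finite
    lists of pairs (code of a coordinate, index of a basic set). *)
Lemma config_measurable_base (I : Type) d (X : topMeasurableType d) :
  countable [set: I] -> measurable_base X -> measurable_base (config I X).
Proof.
move=> /countable_injP[e einj] [B mB Bx].
pose cyl (kn : nat * nat) : set (config I X) :=
  [set x | forall i, e i = kn.1 -> B kn.2 (x i)].
pose C (l : seq (nat * nat)) : set (config I X) :=
  [set x | forall kn, kn \in l -> cyl kn x].
apply: (@measurable_base_count (seq (nat * nat)%type) _ _ C) => [l|x A xA].
  have -> : C l = \bigcap_(kn in [set` l]) cyl kn by [].
  apply: fin_bigcap_measurable; first exact: finite_seq.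
  move=> [k n] _.
  have [[i eik]|noi] := pselect (exists i, e i = k).
    have -> : cyl (k, n) = (fun x : config I X => x i) @^-1` B n.
      apply/seteqP; split => y /=; first by apply.
      by move=> Bny j /= ejk; rewrite (einj j i) ?inE// ejk.
    by rewrite -[X in measurable X]setTI; exact: measurable_coord.
  have -> : cyl (k, n) = setT.
    by apply/seteqP; split => // y _ i /= eik; case: noi; exists i.
  exact: measurableT.
pose F : set_system (config I X) := filter_from [set l | C l x] C.
have FF : Filter F.
  apply: filter_from_filter; first by exists [::].
  move=> l l' Cl Cl'; exists (l ++ l').
    by move=> kn; rewrite mem_cat => /orP[/Cl|/Cl'].
  by move=> y Cy; split => kn knl; apply: Cy; rewrite mem_cat knl ?orbT.
suff /(_ A xA)[l] : F --> x by exists l.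
apply: config_cvg => i P /Bx[n Bnx BnP].
exists [:: (e i, n)].
  by move=> kn; rewrite inE => /eqP -> j /= /einj; rewrite !inE => ->.
by move=> y /(_ (e i, n)); rewrite inE eqxx => /(_ isT i erefl)/BnP.
Qed.

Lemma measurable_continuous d (T : topMeasurableType d) (R : realType)
    (f : T -> R) : measurable_base T -> continuous f -> measurable_fun setT f.
Proof.
move=> bT /continuousP cf; apply: (measurability _ (RGenOpens.measurableE R)).
move=> _ [_ [a [b ->] <-]]; rewrite setTI; apply: measurable_base_open => //.
exact/cf/interval_open.
Qed.

Section continuous_integrable.
Context d (T : topMeasurableType d) (R : realType).
Hypotheses (bT : measurable_base T) (cT : compact [set: T]).

Lemma continuous_bounded (f : T -> R) : continuous f ->
  exists2 M : R, 0 < M & forall x, `|f x| <= M.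
Proof.
move=> cf.
have : compact (f @` setT).
  by apply: continuous_compact => //; exact: continuous_subspaceT.
move=> /compact_bounded[M [_ Mf]]; exists (`|M| + 1).
  by rewrite ltr_wpDl.
by move=> x; apply: (Mf (`|M| + 1)); [exact: ltr_pwDr (ler_norm _)|exists x].
Qed.

Lemma continuous_integrable (P : probability T R) (f : T -> R) :
  continuous f -> P.-integrable setT (EFin \o f).
Proof.
move=> cf; apply: measurable_bounded_integrable => //.
- exact: le_lt_trans (probability_le1 P measurableT) (ltry 1).
- exact: measurable_continuous.
- have [M _ fM] := continuous_bounded cf; exists M; split; first exact: num_real.
  by move=> x Mx y _; exact: le_trans (fM y) (ltW Mx).
Qed.

End continuous_integrable.

(** * Weak* topology, squares of measures and empirical measures *)

(** The weak* topology is initial for the integrals of continuous functions. *)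
Lemma wstar_cvg d (T : topMeasurableType d) (R : realType)
    (F : set_system (wstar T R)) (mu : wstar T R) : Filter F ->
  (forall f : T -> R, continuous f ->
    (fun nu : Prob T R => \int[nu]_x f x) @ F --> \int[mu : Prob T R]_x f x) ->
  F --> mu.
Proof.
move=> FF Fmu; apply: cvg_initial; apply: cvg_prod_topology => f.
by apply: Fmu; exact: cts_fun.
Qed.

Lemma wstar_integral_continuous d (T : topMeasurableType d) (R : realType)
    (f : T -> R) : continuous f ->
  continuous (fun nu : wstar T R => \int[nu : Prob T R]_x f x).
Proof.
move=> cf nu.
apply: (@continuous_comp _ _ _ (@Prob_eval _ T R : wstar T R -> _)
   (fun g : {ptws (continuousType T R) -> R} => g (mkcts cf))).
  exact: initial_continuous.
exact: (@proj_continuous _ (fun=> R : topologicalType)).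
Qed.

Lemma wstar_open_near d (T : topMeasurableType d) (R : realType)
    (f : T -> R) (mu : Prob T R) (eta : R) : continuous f -> 0 < eta ->
  open_nbhs (mu : wstar T R)
    [set nu : wstar T R | `|\int[nu : Prob T R]_x f x - \int[mu]_x f x| < eta].
Proof.
move=> cf eta0; split; last by rewrite /= subrr normr0.
have /continuousP := wstar_integral_continuous cf.
move=> /(_ _ (ball_open (\int[mu]_x f x) eta)).
by congr open; apply/seteqP; split => nu /=; rewrite -ball_normE/= distrC.
Qed.

Section continuous_Rintegral.
Context d (T : topMeasurableType d) (R : realType).
Hypotheses (bT : measurable_base T) (cT : compact [set: T]).
Implicit Types (P : Prob T R) (f g : T -> R).

Lemma Rintegral_cstP P (r : R) : \int[P]_x r = r.
Proof.
by rewrite Rintegral_cst//= probability_setT/= mulr1.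
Qed.

Lemma Rintegral_dist_le P f g (eta : R) : continuous f -> continuous g ->
  (forall x, `|f x - g x| <= eta) -> `|\int[P]_x f x - \int[P]_x g x| <= eta.
Proof.
move=> cf cg fg.
have If := continuous_integrable bT cT P cf.
have Ig := continuous_integrable bT cT P cg.
rewrite -RintegralB//.
have cfg : continuous (fun x => f x - g x).
  by move=> x; apply: cvgB; [exact: cf|exact: cg].
have Ifg := continuous_integrable bT cT P cfg.
apply: le_trans (le_normr_Rintegral measurableT Ifg) _.
rewrite -[leRHS](Rintegral_cstP P); apply: le_Rintegral => //.
- apply: (continuous_integrable bT cT P (f := fun x => `|f x - g x|)) => x.
  by apply: cvg_norm; exact: cfg.
- by apply: (continuous_integrable bT cT P (f := fun=> eta)) => x; exact: cvg_cst.
Qed.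

Lemma RintegralE P f : continuous f ->
  ((\int[P]_x f x)%:E = \int[P]_x (f x)%:E)%E.
Proof.
move=> cf; rewrite /Rintegral fineK//.
by apply: integrable_fin_num => //; exact: continuous_integrable.
Qed.

End continuous_Rintegral.

Section square_integral.
Context (I : Type) d (X : topMeasurableType d) (R : realType).
Hypotheses (cI : countable [set: I]) (bX : measurable_base X).
Hypothesis cX : compact [set: X].

Let bC : measurable_base (config I X).
Proof. exact: config_measurable_base. Qed.

Let cC : compact [set: config I X].
Proof. exact: config_compact. Qed.

Let bC2 : measurable_base (config I (X * X)%type).
Proof. by apply: config_measurable_base => //; exact: prod_measurable_base. Qed.

Let cC2 : compact [set: config I (X * X)%type].
Proof. by apply: config_compact; rewrite -setXTT; exact: compact_setX. Qed.

Lemma config_pair_continuous : continuous (@config_pair I d X).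
Proof.
move=> z; apply: config_cvg => i.
have c1 : (fun z : config I X * config I X => z.1 i) @ z --> z.1 i.
  apply: (@continuous_comp _ _ _ fst (fun x : config I X => x i)).
    exact: cvg_fst.
  exact: config_coord_continuous.
have c2 : (fun z : config I X * config I X => z.2 i) @ z --> z.2 i.
  apply: (@continuous_comp _ _ _ snd (fun x : config I X => x i)).
    exact: cvg_snd.
  exact: config_coord_continuous.
exact: (cvg_pair c1 c2).
Qed.

(** The tube lemma: uniformity in the second variable comes from compactness of
    the second factor. *)
Lemma tube (Phi : config I X * config I X -> R) (x : config I X) (eta : R) :
  continuous Phi -> 0 < eta ->
  \forall x' \near x, forall y, `|Phi (x', y) - Phi (x, y)| <= eta.
Proof.
move=> cPhi eta0.
have /compact_near_coveringP := cC.
move=> /(_ _ (nbhs x) (fun x' y => `|Phi (x', y) - Phi (x, y)| <= eta) _).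
have cov : forall y, [set: config I X] y ->
    \forall y' \near y & x' \near x, `|Phi (x', y') - Phi (x, y')| <= eta.
  move=> y _.
  have /cvgrPdist_lt/(_ (eta / 2)) := cPhi (x, y).
  rewrite divr_gt0// => /(_ isT)[[P Q] [/= Px Qy] PQ].
  exists (Q, P) => //= -[y' x'] [/= Qy' Px'].
  have h1 := PQ (x', y') (conj Px' Qy').
  have h2 := PQ (x, y') (conj (nbhs_singleton Px) Qy').
  rewrite /= in h1 h2.
  rewrite distrC (@splitr _ eta).
  rewrite -(subrKA (Phi (x, y))) (le_trans (ler_normD _ _))//.
  by rewrite lerD// ltW// distrC.
by move=> /(_ cov); apply: filterS => x' h y; exact: h.
Qed.

Lemma section_continuous (Phi : config I X * config I X -> R) x :
  continuous Phi -> continuous (fun y => Phi (x, y)).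
Proof.
move=> cPhi y; apply: (@continuous_comp _ _ _ (fun y => (x, y)) Phi).
  move=> A [[P Q] [/= Px Qy] PQA]; apply: filterS Qy => y' Qy'; apply: PQA.
  by split => //=; exact: nbhs_singleton Px.
exact: cPhi.
Qed.

Lemma Rintegral_section_continuous (Phi : config I X * config I X -> R)
    (P : Prob (config I X) R) : continuous Phi ->
  continuous (fun x => \int[P]_y Phi (x, y)).
Proof.
move=> cPhi x; apply/(@cvgrPdist_le _ _ _ _ (nbhs_filter x)) => eta eta0.
have := tube x cPhi eta0; apply: filterS => x' h.
apply: Rintegral_dist_le => //; try exact: section_continuous.
by move=> y; rewrite distrC.
Qed.

Lemma Rintegral_square (P : Prob (config I X) R)
    (F : config I (X * X)%type -> R) : continuous F ->
  \int[square P]_z F z = \int[P]_x \int[P]_y F (config_pair (x, y)).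
Proof.
move=> cF; have cPhi : continuous (F \o @config_pair I d X).
  move=> z; apply: continuous_comp; [exact: config_pair_continuous|exact: cF].
have cPhi2 := @Rintegral_section_continuous _ P cPhi.
have bCC := prod_measurable_base bC bC.
have cCC : compact [set: config I X * config I X].
  by rewrite -setXTT; exact: compact_setX.
have IF := continuous_integrable bCC cCC (P \x P)%E cPhi.
apply: EFin_inj; rewrite (RintegralE bC2)// (RintegralE bC)//.
rewrite (integral_pushforward (@measurable_config_pair I d X)); last first.
- by [].
- exact: IF.
- by apply/measurable_EFinP; exact: measurable_continuous.
rewrite preimage_setT -integral12_prod_meas1//.
apply: eq_integral => x _; rewrite (RintegralE bC)//.
exact: (@section_continuous (F \o @config_pair I d X) x cPhi).
Qed.

(** For P near mu, the partial integrals of a continuous function of two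
    configurations converge uniformly in the first variable, by compactness;
    so in the double integral the inner measure P may be replaced by mu up to a
    uniform error, and what remains is a single integral against P. *)
Lemma square_continuous :
  continuous (fun P : wstar (config I X) R =>
                (square (P : Prob (config I X) R) : wstar (config I (X * X)%type) R)).
Proof.
move=> mu; apply: wstar_cvg => [|F cF]; first exact/fmap_filter/nbhs_filter.
apply/(@cvgrPdist_le _ _ _ _ (nbhs_filter mu)) => eta eta0.
have cPhi : continuous (F \o @config_pair I d X).
  move=> z; apply: continuous_comp; [exact: config_pair_continuous|exact: cF].
set Phi := F \o _ in cPhi.
pose phi (P : Prob (config I X) R) x := \int[P]_y Phi (x, y).
have cphi P : continuous (phi P) by exact: Rintegral_section_continuous.
pose e := eta / 4; have e0 : 0 < e by rewrite divr_gt0.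
have phi_near x0 : \forall x \near x0, forall P, `|phi P x - phi P x0| <= e.
  have := tube x0 cPhi e0; apply: filterS => x h P.
  by apply: Rintegral_dist_le => //; exact: section_continuous.
have nearx f : continuous f -> \forall nu \near mu,
    `|\int[mu : Prob _ _]_x f x - \int[nu : Prob (config I X) R]_x f x| <= e.
  move=> cf; have /cvgrPdist_le := @wstar_integral_continuous _ _ R f cf mu.
  exact.
have stepA : \forall nu \near mu, forall x,
    `|phi mu x - phi (nu : Prob (config I X) R) x| <= e *+ 3.
  have /compact_near_coveringP := cC.
  move=> /(_ _ (nbhs mu) (fun nu x =>
    `|phi mu x - phi (nu : Prob (config I X) R) x| <= e *+ 3) _) cov.
  have /cov : forall x, [set: config I X] x -> \forall x' \near x & nu \near mu,
      `|phi mu x' - phi (nu : Prob (config I X) R) x'| <= e *+ 3.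
    move=> x0 _.
    exists ([set x | forall P, `|phi P x - phi P x0| <= e],
            [set nu | `|phi mu x0 - phi (nu : Prob _ R) x0| <= e]).
      split => /=; first exact: phi_near.
      by apply: (nearx (fun y => Phi (x0, y))); exact: section_continuous.
    move=> [x nu] [/= h1 h2].
    have := h1 mu; have := h1 nu; rewrite !ler_norml; move: h2; rewrite ler_norml.
    by move=> /andP[? ?] /andP[? ?] /andP[? ?]; apply/andP; split; lra.
  by apply: filterS => nu h x; exact: h.
have stepB := nearx _ (cphi mu).
have := @filterI _ _ (nbhs_filter mu) _ _ stepA stepB.
apply: filterS => nu [h1 h2].
rewrite !Rintegral_square//.
have h3 : `|\int[nu : Prob (config I X) R]_x phi mu x -
    \int[nu : Prob (config I X) R]_x phi nu x| <= e *+ 3.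
  by apply: Rintegral_dist_le => //; exact: cphi.
rewrite -(subrKA (\int[nu : Prob (config I X) R]_x phi mu x)).
apply: le_trans (ler_normD _ _) _.
have -> : eta = e + e *+ 3 by rewrite /e; field.
exact: lerD.
Qed.

End square_integral.

Section empirical_integral.
Context (G : groupType) d (X : topMeasurableType d) (R : realType).
Context (V : finType) (sigma : G -> {perm V}) (V_gt0 : (0 < #|V|)%N).
Hypotheses (bG : measurable_base (config G X)) (cG : compact [set: config G X]).

Lemma pullback_continuous v : continuous (@pullback G d X V sigma v).
Proof.
move=> x; apply: config_cvg => [|g]; first exact/fmap_filter/nbhs_filter.
exact: (@config_coord_continuous V d X (sigma g v) x).
Qed.

(** Only nonnegative functions are treated here: the formulas for integrals
    against a scaled sum of measures hold for them without integrability. *)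
Lemma integral_empirical (f : config G X -> R) x : measurable_fun setT f ->
  (forall z, 0 <= f z) ->
  (\int[empirical R sigma V_gt0 x : probability _ R]_z (f z)%:E =
  (#|V|%:R^-1 * \sum_(v : V) f (pullback sigma v x))%:E)%E.
Proof.
move=> mf f0.
have r0 : 0 <= #|V|%:R^-1 :> R by rewrite invr_ge0.
pose v0 : V := enum_val (Ordinal V_gt0).
pose m (k : nat) : {measure set (config G X) -> \bar R} :=
  \d_(pullback sigma (nth v0 (enum V) k) x).
have mEf : measurable_fun setT (EFin \o f) by exact/measurable_EFinP.
rewrite (@eq_measure_integral _ _ _ _ (mscale (NngNum r0) (msum m #|V|))); last first.
  move=> A mA _ /=; rewrite /empirical /mscale/= /msum; congr (_ * _)%E.
  by rewrite -[LHS]big_enum/= (big_nth v0) -cardE big_mkord.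
have f0E z : [set: config G X] z -> (0 <= (f z)%:E)%E by rewrite lee_fin.
rewrite ge0_integral_mscale// ge0_integral_measure_sum//.
rewrite EFinM; congr (_ * _)%E.
rewrite -sumEFin -[RHS]big_enum/= (big_nth v0) -cardE big_mkord.
apply: eq_bigr => k _; rewrite integral_dirac//= diracE in_setT mul1e//.
Qed.

Lemma Rintegral_empirical (f : config G X -> R) x : continuous f ->
  \int[empirical R sigma V_gt0 x : probability _ R]_z f z =
  #|V|%:R^-1 * \sum_(v : V) f (pullback sigma v x).
Proof.
move=> cf; have [M M0 fM] := continuous_bounded cG cf.
set P : probability _ R := empirical R sigma V_gt0 x.
have If := continuous_integrable bG cG P cf.
have cM : continuous (fun _ : config G X => M) by apply: cst_continuous.
have IM := continuous_integrable bG cG P cM.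
have h : \int[P]_z (f z + M) = #|V|%:R^-1 * \sum_(v : V) (f (pullback sigma v x) + M).
  rewrite /Rintegral (@integral_empirical (fun z => f z + M))//.
    apply: measurable_continuous => //; exact: continuous_addr.
  by move=> z; have := fM z; rewrite ler_norml => /andP[? _]; lra.
move: h; rewrite RintegralD// Rintegral_cstP big_split/= mulrDr sumr_const.
rewrite -[M *+ _]mulr_natl mulrA mulVf ?mul1r; first exact: addIr.
by rewrite pnatr_eq0 -lt0n.
Qed.

Lemma empirical_continuous :
  continuous (fun x : config V X =>
    (empirical R sigma V_gt0 x : probability _ R) : wstar (config G X) R).
Proof.
move=> x; apply: wstar_cvg => [|f cf]; first exact/fmap_filter/nbhs_filter.
pose g y := #|V|%:R^-1 * \sum_(v : V) f (pullback sigma v y).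
have gE : (fun y => \int[empirical R sigma V_gt0 y : probability _ R]_z f z) = g.
  by apply/funext => y; rewrite Rintegral_empirical.
have cg : continuous g.
  apply: continuous_mulr; first exact: continuous_constr.
  apply: continuous_sumr => v.
  by apply: continuous_compr => //; exact: pullback_continuous.
by rewrite -gE in cg; exact: (cg x).
Qed.

(** Measurability is needed because a measure takes unspecified values outside
    the sigma-algebra. *)
Lemma measurable_Omega (bV : measurable_base (config V X))
    (U : set (wstar (config G X) R)) :
  open U -> measurable (Omega sigma V_gt0 U).
Proof.
move=> oU; apply: measurable_base_open => //.
by have /continuousP := empirical_continuous; exact.
Qed.

End empirical_integral.

(** * Events of high probability and domination of measures *)

Section whp.
Context (R : realType).

(** With high probability, in the quantitative form that passes to dominated
    measures and to intersections. *)
Definition whp (T : nat -> Type) (P : forall n, set (T n) -> \bar R)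
    (A : forall n, set (T n)) : Prop :=
  forall e : R, 0 < e -> \forall n \near \oo, ((1 - e)%:E < P n (A n))%E.

Lemma whp_cvg (dT : nat -> measure_display) (T : forall n, measurableType (dT n))
    (P : forall n, probability (T n) R) (A : forall n, set (T n)) :
  (forall n, measurable (A n)) ->
  P n (A n) @[n --> \oo] --> 1%E <-> whp (fun n => P n) A.
Proof.
move=> mA; split => [PA e e0|hA].
  have PA' : fine (P n (A n)) @[n --> \oo] --> (1 : R) by apply: fine_cvg.
  have /cvgrPdist_lt/(_ _ e0) := PA'.
  apply: filterS => n; rewrite ltr_norml => /andP[_ h].
  rewrite -(@fineK _ (P n (A n))) ?fin_num_measure// lte_fin.
  by rewrite ltrBlDl addrC -ltrBlDl.
suff h : fine (P n (A n)) @[n --> \oo] --> (1 : R).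
  by apply: cvg_EFin h; apply: nearW => n; exact: fin_num_measure.
apply/cvgrPdist_lt => e e0; have := hA e e0; apply: filterS => n.
have := probability_le1 (P n) (mA n).
rewrite -(@fineK _ (P n (A n))) ?fin_num_measure// lte_fin lee_fin => h1 h2.
by rewrite ger0_norm ?subr_ge0// ltrBlDl addrC -ltrBlDl.
Qed.

Lemma whp_dominated (dT : nat -> measure_display)
    (T : forall n, measurableType (dT n))
    (P Q : forall n, probability (T n) R) (A : forall n, set (T n)) (C : R) :
  0 < C -> (forall n, measurable (A n)) ->
  (forall n B, measurable B -> (Q n B <= C%:E * P n B)%E) ->
  whp (fun n => P n) A -> whp (fun n => Q n) A.
Proof.
move=> C0 mA QP hA e e0; have := hA (e / C) (divr_gt0 e0 C0); apply: filterS => n.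
have := QP n _ (measurableC (mA n)); rewrite !probability_setC//.
rewrite -(@fineK _ (P n (A n))) ?fin_num_measure//.
rewrite -(@fineK _ (Q n (A n))) ?fin_num_measure//.
rewrite -!EFinB -EFinM lee_fin !lte_fin => h1 h2.
have : C * (1 - fine (P n (A n))) < C * (e / C) by rewrite ltr_pM2l//; lra.
by rewrite mulrCA divff ?lt0r_neq0// mulr1 => h3; lra.
Qed.

Definition most (V : nat -> finType) (A : forall n, set (V n)) : Prop :=
  forall e : R, 0 < e -> \forall n \near \oo,
    1 - e < #|[pred v | `[< A n v >]]|%:R / #|V n|%:R.

Lemma most_cvg (V : nat -> finType) (V_gt0 : forall n, (0 < #|V n|)%N)
    (A : forall n, set (V n)) :
  (#|[pred v | `[< A n v >]]|%:R / #|V n|%:R : R) @[n --> \oo] --> (1 : R) <->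
  most A.
Proof.
split => [/cvgrPdist_lt PA e e0|hA].
  have := PA e e0; apply: filterS => n; rewrite ltr_norml => /andP[_ h].
  by rewrite ltrBlDl addrC -ltrBlDl.
apply/cvgrPdist_lt => e e0; have := hA e e0; apply: filterS => n h2.
rewrite ger0_norm ?subr_ge0 ?ltrBlDl 1?addrC -?ltrBlDl//.
by rewrite ler_pdivrMr ?ltr0n// mul1r ler_nat max_card.
Qed.

(** Being a filter is what allows convergence to be tested on integrals of
    single continuous functions, through [wstar_cvg]. *)
Lemma most_filter (V : nat -> finType) (V_gt0 : forall n, (0 < #|V n|)%N)
    (W : Type) (f : forall n, V n -> W) :
  Filter [set A : set W | most (fun n v => A (f n v))].
Proof.
split => [e e0|A B hA hB e e0|A B AB hA e e0].
- apply: nearW => n; rewrite (eq_card (B := V n)); last first.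
    by move=> v; rewrite !inE; apply/asboolP.
  by rewrite divff ?pnatr_eq0 -?lt0n//; lra.
- have := hA (e / 2) (divr_gt0 e0 (ltr0n _ 2)).
  have := hB (e / 2) (divr_gt0 e0 (ltr0n _ 2)).
  apply: filterS2 => n hBn hAn.
  have Vn0 : (0 : R) < #|V n|%:R by rewrite ltr0n.
  rewrite ltr_pdivlMr// in hBn; rewrite ltr_pdivlMr// in hAn.
  rewrite ltr_pdivlMr//.
  set a := [pred v | `[< A (f n v) >]]; set b := [pred v | `[< B (f n v) >]].
  rewrite -/a in hAn; rewrite -/b in hBn.
  have -> : #|[pred v | `[< (A `&` B) (f n v) >]]| = #|[predI a & b]|.
    by apply: eq_card => v; rewrite !inE; apply/asboolP/andP => -[/asboolP ? /asboolP].
  have h1 : #|[predU a & b]|%:R <= #|V n|%:R :> R by rewrite ler_nat max_card.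
  have h2 : #|[predU a & b]|%:R + #|[predI a & b]|%:R = #|a|%:R + #|b|%:R :> R.
    by rewrite -!natrD cardUI.
  by lra.
- have := hA e e0; apply: filterS => n h; apply: lt_le_trans h _.
  rewrite ler_pM2r ?invr_gt0 ?ltr0n// ler_nat; apply: subset_leq_card.
  apply/fintype.subsetP => v; rewrite !unfold_in /= => /asboolP h'; apply/asboolP; exact: (AB _ h').
Qed.

End whp.

Section dominated.
Context (R : realType) d (T : measurableType d).
Variables (P Q : probability T R) (C : R).
Hypotheses (C0 : 0 <= C) (QP : forall A, measurable A -> (Q A <= C%:E * P A)%E).

Lemma dominated_integral (f : T -> \bar R) : measurable_fun setT f ->
  (forall x, 0 <= f x)%E -> (\int[Q]_x f x <= C%:E * \int[P]_x f x)%E.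
Proof.
move=> mf f0; have := @ge0_integral_mscale _ _ _ P _ measurableT (NngNum C0) f mf (fun x _ => f0 x).
move=> /= <-; apply: ge0_le_measure_integral => //.
Qed.

Lemma dominated_product (A : set (T * T)) : measurable A ->
  ((Q \x Q) A <= (C * C)%:E * (P \x P) A)%E.
Proof.
move=> mA; rewrite /product_measure1/=.
have mP := measurable_fun_xsection P mA.
have mQ := measurable_fun_xsection Q mA.
apply: le_trans (dominated_integral mQ _) _ => //.
rewrite EFinM -muleA lee_wpmul2l ?lee_fin//.
rewrite -ge0_integralZl ?lee_fin//.
apply: ge0_le_integral => //.
- exact: measurable_funeM.
- by move=> x _; apply: QP; exact: measurable_xsection.
Qed.

End dominated.

(** * Locally and doubly empirical convergence under domination *)

(** Needed for measures that agree on all measurable sets but are not equal as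
    functions on all sets. *)
Lemma wstar_open_eval d (T : topMeasurableType d) (R : realType)
    (U : set (wstar T R)) (P Q : Prob T R) : open U ->
  (forall f : T -> R, continuous f -> \int[P]_x f x = \int[Q]_x f x) ->
  U P -> U Q.
Proof.
move=> [B oB <-] PQ; rewrite /preimage/=.
suff -> : Prob_eval P = Prob_eval Q by [].
by apply/funext => f; apply: PQ; exact: cts_fun.
Qed.

Definition vmean (R : realType) (V : finType) (F : V -> R) : R :=
  #|V|%:R^-1 * \sum_(v : V) F v.

Lemma Rintegral_distribution d d' (T : topMeasurableType d)
    (T' : topMeasurableType d') (R : realType)
    (bT : measurable_base T) (cT : compact [set: T]) (bT' : measurable_base T')
    (P : Prob T R) (X : {mfun T >-> T'}) (f : T' -> R) :
  continuous X -> continuous f ->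
  \int[distribution P X]_y f y = \int[P]_x f (X x).
Proof.
move=> cX cf; rewrite /Rintegral integral_pushforward//=.
- by apply/measurable_EFinP; exact: measurable_continuous.
- apply: (continuous_integrable bT cT P (f := f \o X)).
  exact: continuous_compr.
Qed.

Lemma Rintegral_sum_continuous d (T : topMeasurableType d) (R : realType)
    (bT : measurable_base T) (cT : compact [set: T])
    (P : Prob T R) (I : finType) (f : I -> T -> R) :
  (forall i, continuous (f i)) ->
  \int[P]_x (\sum_i f i x) = \sum_i \int[P]_x f i x.
Proof.
move=> cf; rewrite /index_enum; elim: (Finite.enum I) => [|i s IHs].
  under eq_Rintegral => x _ do rewrite big_nil.
  by rewrite big_nil Rintegral_cstP.
under eq_Rintegral => x _ do rewrite big_cons.
rewrite big_cons -IHs RintegralD//.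
- exact: continuous_integrable.
- apply: (continuous_integrable bT cT P (f := fun x => \sum_(j <- s) f j x)).
  by apply: continuous_big => // z; exact: add_continuous.
Qed.

Lemma Rintegral_le_outside d (T : topMeasurableType d) (R : realType)
    (bT : measurable_base T) (cT : compact [set: T])
    (P : Prob T R) (f : T -> R) (S : set T) (a M : R) :
  continuous f -> measurable S -> 0 <= a -> 0 <= M ->
  (forall x, f x <= M) -> (forall x, S x -> f x <= a) ->
  \int[P]_x f x <= a + M * (1 - fine (P S)).
Proof.
move=> cf mS a0 M0 fM fa.
have If := continuous_integrable bT cT P cf.
have Ind : P.-integrable setT (EFin \o (\1_(~` S) : T -> R)).
  by apply: integrable_indic => //; exact: measurableC.
have IM : P.-integrable setT (EFin \o (fun x => M * \1_(~` S) x)).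
  exact: (integrableZl measurableT M Ind).
have Ia : P.-integrable setT (EFin \o (fun _ : T => a)).
  by apply: (continuous_integrable bT cT P (f := cst a)); exact: continuous_constr.
apply: (@le_trans _ _ (\int[P]_x (a + M * \1_(~` S) x))).
  apply: le_Rintegral => //; first exact: (integrableD measurableT Ia IM).
  move=> x _; have [Sx|nSx] := pselect (S x).
    by rewrite indicE memNset ?mulr0 ?addr0; [exact: fa|exact].
  by rewrite indicE mem_set// mulr1 (le_trans (fM x))// lerDr.
rewrite RintegralD// Rintegral_cstP lerD2l RintegralZl//.
rewrite ler_wpM2l// /Rintegral integral_indic//; last exact: measurableC.
rewrite setIT/= probability_setC// fineB//.
exact: fin_num_measure.
Qed.

Section config_projections.
Context (I : Type) d (X : topMeasurableType d).

Definition config_fst (z : config I (X * X)%type) : config I X := fun i => (z i).1.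
Definition config_snd (z : config I (X * X)%type) : config I X := fun i => (z i).2.

Lemma config_fst_continuous : continuous config_fst.
Proof.
move=> z; have Fz := @config_cvg I d X (config_fst @ nbhs z) (config_fst z).
apply: Fz => i.
have h : {for z, continuous (fun z : config I (X * X)%type => z i)}.
  exact: (@config_coord_continuous I _ (X * X)%type i z).
have h2 : {for (z i), continuous (@fst X X)} by exact: cvg_fst.
exact: (@continuous_comp _ _ _ (fun z : config I (X * X)%type => z i) fst z h h2).
Qed.

Lemma config_snd_continuous : continuous config_snd.
Proof.
move=> z; have Fz := @config_cvg I d X (config_snd @ nbhs z) (config_snd z).
apply: Fz => i.
have h : {for z, continuous (fun z : config I (X * X)%type => z i)}.
  exact: (@config_coord_continuous I _ (X * X)%type i z).
have h2 : {for (z i), continuous (@snd X X)} by exact: cvg_snd.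
exact: (@continuous_comp _ _ _ (fun z : config I (X * X)%type => z i) snd z h h2).
Qed.

End config_projections.

Section lde.
Context (R : realType) (G : groupType) (countableG : countable [set: G]).
Context (V : nat -> finType) (V_gt0 : forall n, (0 < #|V n|)%N).
Context (sigma : forall n, G -> {perm V n}).
Context d (X : topMeasurableType d).
Hypotheses (bX : measurable_base X) (cX : compact [set: X]).

Let bXX : measurable_base (X * X)%type.
Proof. exact: prod_measurable_base. Qed.
Let cXX : compact [set: (X * X)%type].
Proof. by rewrite -setXTT; exact: compact_setX. Qed.
Let bG : measurable_base (config G X).
Proof. exact: config_measurable_base. Qed.
Let cG : compact [set: config G X].
Proof. exact: config_compact. Qed.
Let bGG : measurable_base (config G (X * X)%type).
Proof. exact: config_measurable_base. Qed.
Let cGG : compact [set: config G (X * X)%type].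
Proof. exact: config_compact. Qed.

Let cV n : countable [set: V n].
Proof. exact: countableP. Qed.
Let bV n : measurable_base (config (V n) X).
Proof. exact: config_measurable_base. Qed.
Let cVc n : compact [set: config (V n) X].
Proof. exact: config_compact. Qed.
Let bVV n : measurable_base (config (V n) (X * X)%type).
Proof. exact: config_measurable_base. Qed.
Let cVV n : compact [set: config (V n) (X * X)%type].
Proof. exact: config_compact. Qed.

Implicit Types (mu : Prob (config G X) R)
  (mus nus : forall n, Prob (config (V n) X) R).

(** The empirical half of lde convergence, read on one continuous function. *)
Lemma lde_pair_law mus mu (F : config G (X * X)%type -> R) (eta : R) :
  lde_cvg V_gt0 sigma mus mu -> continuous F -> 0 < eta ->
  whp (fun n => square (mus n)) (fun n => [set z |
    `|vmean (fun v => F (pullback (sigma n) v z)) - \int[square mu]_z F z| < eta]).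
Proof.
move=> [_ h] cF eta0.
have oU := wstar_open_near (square mu) cF eta0.
have {}h := h _ oU.
have mO n := measurable_Omega (sigma n) (V_gt0 n) bGG cGG (bVV n) oU.1.
move/whp_cvg : h => /(_ mO) h e e0; have := h e e0; apply: filterS => n.
set A := Omega _ _ _; set B := [set z | _]; suff -> : A = B by [].
by apply/seteqP; split => z; rewrite /A /B /Omega/= Rintegral_empirical.
Qed.

Lemma law_measurable n (f : config G X -> R) (a eta : R) : continuous f ->
  measurable [set x : config (V n) X |
    `|vmean (fun v => f (pullback (sigma n) v x)) - a| < eta].
Proof.
move=> cf.
pose h (z : config (V n) X) :=
  `|vmean (fun v => f (pullback (sigma n) v z)) - a|.
have ch : continuous h.
  apply: continuous_normr; apply: continuous_subr; last exact: continuous_constr.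
  apply: continuous_mulr; first exact: continuous_constr.
  apply: continuous_sumr => v.
  by apply: continuous_compr => //; exact: pullback_continuous.
have /(measurable_continuous (bV n)) mh := ch.
by have := mh measurableT _ (measurable_itv `]-oo, eta[); rewrite setTI set_itvE.
Qed.

Lemma product_law_measurable n (f g : config G X -> R) (a eta : R) :
  continuous f -> continuous g ->
  measurable [set p : config (V n) X * config (V n) X |
    `|vmean (fun v => f (pullback (sigma n) v p.1) * g (pullback (sigma n) v p.2))
     - a| < eta].
Proof.
move=> cf cg.
pose h (p : config (V n) X * config (V n) X) :=
  `|vmean (fun v => f (pullback (sigma n) v p.1) * g (pullback (sigma n) v p.2))
     - a|.
have ch : continuous h.
  apply: continuous_normr; apply: continuous_subr; last exact: continuous_constr.
  apply: continuous_mulr; first exact: continuous_constr.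
  apply: continuous_sumr => v; apply: continuous_mulr.
    have c1 : continuous (fun x => f (pullback (sigma n) v x)).
      by apply: continuous_compr => //; exact: pullback_continuous.
    apply: (continuous_compr (h := fst) _ c1) => p; exact: cvg_fst.
  have c1 : continuous (fun x => g (pullback (sigma n) v x)).
    by apply: continuous_compr => //; exact: pullback_continuous.
  apply: (continuous_compr (h := snd) _ c1) => p; exact: cvg_snd.
have /measurable_continuous mh := ch.
have := mh (prod_measurable_base (bV n) (bV n)) measurableT _ (measurable_itv `]-oo, eta[).
by rewrite setTI set_itvE.
Qed.

Lemma lde_product_law mus mu (f g : config G X -> R) (eta : R) :
  lde_cvg V_gt0 sigma mus mu -> continuous f -> continuous g -> 0 < eta ->
  whp (fun n => mus n \x mus n)%E (fun n => [set p : config _ X * config _ X |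
    `|vmean (fun v => f (pullback (sigma n) v p.1) * g (pullback (sigma n) v p.2))
      - \int[mu]_x f x * \int[mu]_x g x| < eta]).
Proof.
move=> hlde cf cg eta0.
pose F (z : config G (X * X)%type) := f (config_fst z) * g (config_snd z).
have cF : continuous F.
  apply: continuous_mulr; apply: continuous_compr => //.
    exact: config_fst_continuous.
  exact: config_snd_continuous.
have := lde_pair_law hlde cF eta0.
rewrite Rintegral_square//.
under eq_Rintegral => x _.
  rewrite /F/=.
  have -> : \int[mu]_y (f x * g y) = f x * \int[mu]_x g x.
    by rewrite RintegralZl//; exact: continuous_integrable.
  over.
rewrite RintegralZr//; exact: continuous_integrable.
Qed.

Lemma lde_law mus mu (f : config G X -> R) (eta : R) :
  lde_cvg V_gt0 sigma mus mu -> continuous f -> 0 < eta ->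
  whp (fun n => mus n) (fun n => [set x |
    `|vmean (fun v => f (pullback (sigma n) v x)) - \int[mu]_x f x| < eta]).
Proof.
move=> hlde cf eta0 e e0.
have := lde_product_law hlde cf (@continuous_constr _ _ 1) eta0 e0.
apply: filterS => n; set A := [set p | _]; set B := [set x | _].
have mB : measurable B by exact: law_measurable.
have -> : A = B `*` setT.
  have int1 : \int[mu]_x (fun=> 1 : R) x = 1 by exact: Rintegral_cstP.
  have vE x : vmean (fun v => f (pullback (sigma n) v x) * 1) =
      vmean (fun v => f (pullback (sigma n) v x)).
    by congr vmean; apply/funext => v; rewrite mulr1.
  by apply/seteqP; split => -[x y]; rewrite /A /B/= int1 mulr1 vE => // -[].
by rewrite product_measure1E//= probability_setT mule1.
Qed.

Definition most_integrals mus mu : Prop :=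
  forall (f : config G X -> R) (eta : R), continuous f -> 0 < eta ->
  most R (fun n => [set v |
    `|\int[mus n]_x f (pullback (sigma n) v x) - \int[mu]_x f x| < eta]).

(** Local convergence of squares follows from that of the measures themselves:
    pulling back commutes with squaring, and squaring is continuous. *)
Lemma most_integrals_lw mus mu : most_integrals mus mu ->
  lw_cvg sigma (fun n => square (mus n)) (square mu).
Proof.
move=> h U oU; apply/most_cvg => //.
have Udist n v : U (square (distribution (mus n) (pullback (sigma n) v))) ->
    U (distribution (square (mus n)) (pullback (sigma n) v)).
  apply: wstar_open_eval oU.1 _ => F cF.
  have pc : continuous (@pullback G _ X (V n) (sigma n) v).
    exact: pullback_continuous.
  have pcc : continuous (@pullback G _ (X * X)%type (V n) (sigma n) v).
    exact: pullback_continuous.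
  have cFp : continuous (F \o @config_pair G _ X).
    by apply: continuous_compr => //; exact: config_pair_continuous.
  have cPhi (P : Prob (config G X) R) : continuous (fun x => \int[P]_y F (config_pair (x, y))).
    exact: (@Rintegral_section_continuous G d X R countableG bX cX _ P cFp).
  have cPhi2 z : continuous (fun y => F (config_pair (z, y))).
    exact: (@section_continuous G d X R (F \o @config_pair _ _ _) z cFp).
  rewrite (Rintegral_distribution (bVV n) (@cVV n) bGG _ pcc cF).
  rewrite !Rintegral_square//; last exact: continuous_compr.
  rewrite (Rintegral_distribution (bV n) (@cVc n) bG _ pc (cPhi _)).
  apply: eq_Rintegral => x _.
  by rewrite (Rintegral_distribution (bV n) (@cVc n) bG _ pc (cPhi2 _)).
pose pd n v : wstar (config G X) R :=
  (distribution (mus n) (pullback (sigma n) v) : Prob (config G X) R).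
pose F : set_system (wstar (config G X) R) :=
  [set A | most R (fun n v => A (pd n v))].
have FF : Filter F by exact: most_filter.
have Fmu : F --> (mu : wstar _ _).
  apply: wstar_cvg => f cf; apply/cvgrPdist_lt => eta eta0.
  have := h f eta cf eta0; move=> hf e e0; have := hf e e0.
  apply: filterS => n; move/lt_le_trans; apply.
  rewrite ler_pM2r ?invr_gt0 ?ltr0n// ler_nat; apply: subset_leq_card.
  apply/fintype.subsetP => v; rewrite !unfold_in/= => /asboolP h'; apply/asboolP.
  rewrite distrC (Rintegral_distribution (bV n) (@cVc n) bG _ _ cf)//.
  exact: pullback_continuous.
suff : F [set nu | U (square nu)].
  move=> hF e e0; have := hF e e0; apply: filterS => n; move/lt_le_trans; apply.
  rewrite ler_pM2r ?invr_gt0 ?ltr0n// ler_nat; apply: subset_leq_card.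
  by apply/fintype.subsetP => v; rewrite !unfold_in/= => /asboolP h'; apply/asboolP; exact: Udist.
apply: Fmu.
have := @square_continuous G d X R countableG bX cX mu.
apply; exact: open_nbhs_nbhs.
Qed.

Lemma chebyshev (W : finType) (a : W -> R) (c eta : R) : (0 < #|W|)%N ->
  0 < eta -> vmean (fun v => a v * a v) <= c ->
  1 - c / eta ^+ 2 <= #|[pred v | `[< `|a v| < eta >]]|%:R / #|W|%:R.
Proof.
move=> W0 eta0; rewrite /vmean => hc.
have WR : 0 < #|W|%:R :> R by rewrite ltr0n.
set b := [pred v | _].
have hb : \sum_v a v * a v >= eta ^+ 2 * (#|W|%:R - #|b|%:R).
  apply: (@le_trans _ _ (\sum_(v | v \notin b) a v * a v)).
    apply: (@le_trans _ _ (\sum_(v | v \notin b) eta ^+ 2)).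
      rewrite sumr_const -[X in _ <= X]mulr_natr ler_pM2l ?exprn_gt0//.
      have := cardC b; move=> <-; rewrite natrD addrC addKr.
      by rewrite ler_nat; apply: subset_leq_card; apply/fintype.subsetP => v; rewrite !inE.
    apply: ler_sum => v; rewrite !unfold_in/= => /asboolPn/negP; rewrite -leNgt => h.
    by rewrite -expr2 -(real_normK (num_real (a v))) lerXn2r ?nnegrE// ltW.
  by rewrite [leRHS](bigID (mem b))/= lerDr sumr_ge0// => v _; rewrite -expr2 sqr_ge0.
have hcW : \sum_v a v * a v <= c * #|W|%:R.
  by move: hc; rewrite mulrC ler_pdivrMr.
rewrite ler_pdivlMr// mulrBl mul1r lerBlDr -lerBlDl mulrAC.
rewrite ler_pdivlMr ?exprn_gt0//; apply: le_trans hcW.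
by rewrite mulrC.
Qed.

(** The second moment argument.  With f0 = f - (mean of f under mu), the mean of
    f0 (x) f0 (y) over two independent configurations, averaged over the
    vertices, is the average of the squares b v * b v of the local means; the
    law for products bounds it, and Chebyshev's inequality concludes. *)
Lemma product_law_most nus mu :
  (forall (f g : config G X -> R) (eta : R), continuous f -> continuous g -> 0 < eta ->
    whp (fun n => nus n \x nus n)%E (fun n => [set p : config _ X * config _ X |
    `|vmean (fun v => f (pullback (sigma n) v p.1) * g (pullback (sigma n) v p.2))
      - \int[mu]_x f x * \int[mu]_x g x| < eta])) ->
  most_integrals nus mu.
Proof.
move=> hlaw f eta cf eta0 e e0.
pose f0 x := f x - \int[mu]_z f z.
have cf0 : continuous f0.
  by apply: continuous_subr => //; exact: continuous_constr.
have If0 : \int[mu]_x f0 x = 0.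
  rewrite RintegralB//.
  - by rewrite Rintegral_cstP subrr.
  - exact: continuous_integrable.
  - by apply: (continuous_integrable bG cG mu (f := cst _)); exact: continuous_constr.
have [M M0 f0M] := continuous_bounded cG cf0.
have MM0 : 0 < M * M by exact: mulr_gt0.
pose a := e * eta ^+ 2 / 4.
have a0 : 0 < a by rewrite divr_gt0// mulr_gt0// exprn_gt0.
have := hlaw f0 f0 a cf0 cf0 a0 (a / (M * M)) (divr_gt0 a0 MM0).
apply: filterS => n; set S := [set p | _] => hS.
pose F v (z : config (V n) (X * X)%type) :=
  f0 (pullback (sigma n) v (config_fst z)) * f0 (pullback (sigma n) v (config_snd z)).
have cfv v : continuous (fun x => f0 (pullback (sigma n) v x)).
  by apply: continuous_compr => //; exact: pullback_continuous.
have cF v : continuous (F v).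
  apply: continuous_mulr; apply: (continuous_compr _ (cfv v)).
  - exact: config_fst_continuous.
  - exact: config_snd_continuous.
pose H z := vmean (F ^~ z).
have cH : continuous H.
  by apply: continuous_mulr; [exact: continuous_constr|exact: continuous_sumr].
pose b v := \int[nus n]_x f0 (pullback (sigma n) v x).
have VR : (0 : R) < #|V n|%:R by rewrite ltr0n.
have intH : \int[square (nus n)]_z H z = vmean (fun v => b v * b v).
  rewrite /H /vmean RintegralZl//; last first.
    apply: (continuous_integrable (bVV n) (@cVV n) _ (f := fun z => \sum_v F v z)).
    exact: continuous_sumr.
  rewrite (Rintegral_sum_continuous (bVV n) (@cVV n) _ cF); congr (_ * _); apply: eq_bigr => v _.
  rewrite Rintegral_square//.
  under eq_Rintegral => x _.
    have -> : \int[nus n]_y F v (config_pair (x, y)) =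
        f0 (pullback (sigma n) v x) * b v.
      rewrite -[LHS]/(\int[nus n]_y (f0 (pullback (sigma n) v x) * f0 (pullback (sigma n) v y))).
      by rewrite RintegralZl//; exact: (continuous_integrable (bV n) (@cVc n) _ (cfv v)).
    over.
  by rewrite RintegralZr//; exact: (continuous_integrable (bV n) (@cVc n) _ (cfv v)).
pose S' := [set z | H z < a].
have mS' : measurable S'.
  have /(measurable_continuous (bVV n)) mH := cH.
  by have := mH measurableT _ (measurable_itv `]-oo, a[); rewrite setTI set_itvE.
have hS' : 1 - a / (M * M) < fine (square (nus n) S').
  rewrite -lte_fin fineK ?fin_num_measure//; apply: lt_le_trans hS _.
  have mcp : measurable (@config_pair _ _ X @^-1` S').
    by rewrite -[X in measurable X]setTI; exact: measurable_config_pair.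
  apply: le_measure.
  - by apply: mem_set; exact: product_law_measurable.
  - exact: mem_set.
  - move=> [x y]; rewrite /S/= If0 mul0r subr0 => /(le_lt_trans (ler_norm _)).
    by [].
have HM z : H z <= M * M.
  rewrite /H /vmean mulrC ler_pdivrMr// mulr_natr -sumr_const.
  apply: ler_sum => v _; apply: le_trans (ler_norm _) _; rewrite normrM.
  by apply: ler_pM.
have := Rintegral_le_outside (bVV n) (@cVV n) (square (nus n)) cH mS' (ltW a0)
  (ltW MM0) HM (fun z h => ltW h).
rewrite intH => hb.
have hb' : vmean (fun v => b v * b v) <= a *+ 2.
  apply: le_trans hb _; rewrite mulr2n lerD2l mulrC -ler_pdivlMr//.
  by rewrite lerBlDr -lerBlDl ltW.
have := chebyshev (V_gt0 n) eta0 hb'.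
have -> : a *+ 2 / eta ^+ 2 = e / 2.
  by rewrite /a; field; rewrite lt0r_neq0.
move=> hch; have he : 1 - e < 1 - e / 2 by lra.
apply: (lt_le_trans he); apply: (le_trans hch).
rewrite ler_pM2r ?invr_gt0// ler_nat; apply: subset_leq_card.
apply/fintype.subsetP => v; rewrite !unfold_in/= => /asboolP h'; apply/asboolP.
move: h'; rewrite /b /f0 RintegralB//; last 2 first.
- apply: (continuous_integrable (bV n) (@cVc n) _ (f := fun x => f (pullback (sigma n) v x))).
  by apply: continuous_compr => //; exact: pullback_continuous.
- by apply: (continuous_integrable (bV n) (@cVc n) _ (f := cst _)); exact: continuous_constr.
by rewrite Rintegral_cstP.
Qed.

(** Lde convergence survives domination, in particular conditioning on events
    of mass bounded below.  For the empirical half this is immediate; the local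
    half is recovered from the empirical one. *)
Lemma lde_dominated mus nus mu (C : R) : 0 < C ->
  (forall n A, measurable A -> (nus n A <= C%:E * mus n A)%E) ->
  lde_cvg V_gt0 sigma mus mu -> lde_cvg V_gt0 sigma nus mu.
Proof.
move=> C0 dom hlde; have CC0 : 0 < C * C by exact: mulr_gt0.
split.
  apply: most_integrals_lw; apply: product_law_most => f g eta cf cg eta0.
  have := lde_product_law hlde cf cg eta0.
  apply: (@whp_dominated _ (fun n => _) _ (fun n => mus n \x mus n)%E (fun n => nus n \x nus n)%E _ (C * C)).
  - by [].
  - move=> n; exact: product_law_measurable.
  - by move=> n A mA; apply: dominated_product => //; [exact: ltW|exact: dom].
move=> U oU.
have mO n := measurable_Omega (sigma n) (V_gt0 n) bGG cGG (bVV n) oU.1.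
apply/(whp_cvg _ mO); have /(whp_cvg _ mO) := hlde.2 U oU.
apply: (@whp_dominated _ _ _ (fun n => square (mus n)) (fun n => square (nus n)) _ (C * C)) => //.
move=> n A mA.
have mA' : measurable (@config_pair _ _ X @^-1` A).
  by rewrite -[X in measurable X]setTI; exact: measurable_config_pair.
by apply: dominated_product => //; [exact: ltW|exact: dom].
Qed.

End lde.

(** * Entropy of finite distributions, Hamming balls and upper limits *)

Section finite_entropy.
Context (R : realType) (W : finType).
Implicit Types (p q : W -> R) (S : {set W}).

Definition entropy p : R := - \sum_w p w * ln (p w).

(** From ln t <= t - 1 at t = q w / p w. *)
Lemma gibbs p q : (forall w, 0 <= p w) -> (forall w, 0 < q w) ->
  \sum_w p w = 1 -> \sum_w q w <= 1 ->
  entropy p <= \sum_w p w * - ln (q w).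
Proof.
move=> p0 q0 p1 q1; rewrite /entropy -sumrN -subr_le0 -sumrB.
apply: (@le_trans _ _ (\sum_w (q w - p w))); last by rewrite sumrB p1 subr_le0.
apply: ler_sum => w _; have := p0 w; rewrite le_eqVlt => /predU1P[<-|pw0].
  by rewrite !mul0r !subr0 oppr0 ltW.
have -> : - (p w * ln (p w)) - p w * - ln (q w) = p w * ln (q w / p w).
  by rewrite ln_div ?posrE//; ring.
have qp : 0 < q w / p w by rewrite divr_gt0.
have := @le_ln1Dx R (q w / p w - 1).
have -> : 1 + (q w / p w - 1) = q w / p w by ring.
move=> /(_ _) h; have {}h : ln (q w / p w) <= q w / p w - 1 by apply: h; lra.
apply: le_trans (ler_wpM2l (ltW pw0) h) _.
by rewrite mulrBr mulrCA divff ?lt0r_neq0// !mulr1.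
Qed.

Lemma entropy_ge0 p : (forall w, 0 <= p w <= 1) -> 0 <= entropy p.
Proof.
move=> p01; rewrite /entropy -sumrN sumr_ge0// => w _.
have /andP[p0 p1] := p01 w.
by rewrite -mulrN mulr_ge0// oppr_ge0 ln_le0.
Qed.

(** Gibbs' inequality against the distribution that spreads mass 1 - e uniformly
    over S and mass e uniformly over all words. *)
Lemma entropy_cover p S (e : R) : (forall w, 0 <= p w) -> \sum_w p w = 1 ->
  0 < e < 1 -> 1 - e < \sum_(w in S) p w ->
  entropy p <= ln #|S|%:R - ln (1 - e) + e * (ln #|W|%:R - ln e).
Proof.
move=> p0 p1 /andP[e0 e1] hS.
have S0 : (0 < #|S|)%N.
  rewrite card_gt0; apply/eqP => S0; move: hS; rewrite S0 big_set0; lra.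
have W0 : (0 < #|W|)%N by rewrite (leq_trans S0)// max_card.
have SR : 0 < #|S|%:R :> R by rewrite ltr0n.
have WR : 0 < #|W|%:R :> R by rewrite ltr0n.
have e1' : 0 < 1 - e by lra.
pose q w := if w \in S then (1 - e) / #|S|%:R else e / #|W|%:R.
have q0 w : 0 < q w by rewrite /q; case: ifP => _; rewrite divr_gt0.
have q1 : \sum_w q w <= 1.
  rewrite (bigID (mem S))/=.
  rewrite (eq_bigr (fun=> (1 - e) / #|S|%:R)); last by move=> w wS; rewrite /q wS.
  rewrite [X in _ + X](eq_bigr (fun=> e / #|W|%:R)); last first.
    by move=> w wS; rewrite /q (negbTE wS).
  rewrite sumr_const -[X in X + _]mulr_natr mulfVK ?lt0r_neq0//.
  have : \sum_(w | w \notin S) e / #|W|%:R <= e.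
    rewrite sumr_const -[X in X <= _]mulr_natr mulrAC ler_pdivrMr// ler_pM2l//.
    by rewrite ler_nat max_card.
  lra.
apply: le_trans (gibbs p0 q0 p1 q1) _.
set m := \sum_(w in S) p w in hS.
have hm : \sum_(w | w \notin S) p w = 1 - m.
  by rewrite -p1 [in RHS](bigID (mem S))/= -/m addrAC subrr add0r.
have m1 : m <= 1 by rewrite -subr_ge0 -hm sumr_ge0.
rewrite (bigID (mem S))/=.
rewrite (eq_bigr (fun w => p w * (ln #|S|%:R - ln (1 - e)))); last first.
  by move=> w wS; rewrite /q wS ln_div ?posrE// opprB.
rewrite [X in _ + X](eq_bigr (fun w => p w * (ln #|W|%:R - ln e))); last first.
  by move=> w wS; rewrite /q (negbTE wS) ln_div ?posrE// opprB.
rewrite -!mulr_suml hm -/m lerD//.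
  rewrite ler_piMl// subr_ge0 (@le_trans _ _ 0)// ?ln_le0 ?ln_ge0 ?ler1n//; lra.
rewrite ler_wpM2r//; last by lra.
by rewrite subr_ge0 (@le_trans _ _ 0)// ?ln_le0 ?ln_ge0 ?ler1n//; lra.
Qed.

Lemma entropy_atoms p (h : R) : (forall w, 0 <= p w) -> \sum_w p w = 1 ->
  (forall w, p w <= expR (- h)) -> h <= entropy p.
Proof.
move=> p0 p1 ph; rewrite /entropy -sumrN -[leLHS]mul1r -p1 mulr_suml.
apply: ler_sum => w _; have := p0 w; rewrite le_eqVlt => /predU1P[<-|pw0].
  by rewrite !mul0r oppr0.
rewrite -mulrN ler_pM2l// lerNr -[X in _ <= X]expRK.
by rewrite ler_ln ?posrE ?expR_gt0.
Qed.

End finite_entropy.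

(** The error of [entropy_cover] per vertex, L being the logarithm of the size of
    the alphabet, is at most gamma for small e. *)
Lemma entropy_error (R : realType) (L gamma : R) : 0 <= L -> 0 < gamma ->
  exists2 e : R, 0 < e < 1 & - ln (1 - e) + e * (L - ln e) <= gamma.
Proof.
move=> L0 g0.
(* The witness is e = s ^+ 2, for which - e ln e <= 2 s. *)
pose s := Num.min (2^-1) (gamma / (4 + L)).
have s0 : 0 < s by rewrite lt_min invr_gt0 ltr0n/= divr_gt0//; lra.
have s1 : s <= 2^-1 by rewrite ge_min lexx.
have sg : s * (4 + L) <= gamma.
  by rewrite -ler_pdivlMr ?ge_min ?lexx ?orbT//; lra.
have lnV (x : R) : 0 < x -> - ln x <= x^-1 - 1.
  move=> x0; rewrite -lnV ?posrE//.
  have := @le_ln1Dx R (x^-1 - 1); have -> : 1 + (x^-1 - 1) = x^-1 by ring.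
  by apply; have : 0 < x^-1 by [rewrite invr_gt0]; lra.
exists (s ^+ 2); first by nra.
have h1 : - ln (1 - s ^+ 2) <= 2 * s.
  have x0 : 0 < 1 - s ^+ 2 by nra.
  apply: le_trans (lnV _ x0) _.
  have -> : (1 - s ^+ 2)^-1 - 1 = s ^+ 2 / (1 - s ^+ 2) by field; rewrite lt0r_neq0.
  rewrite ler_pdivrMr//; nra.
have h2 : s ^+ 2 * - ln (s ^+ 2) <= 2 * s.
  rewrite lnXn// -mulNrn.
  have := ler_wpM2l (sqr_ge0 s) (lnV _ s0).
  have -> : s ^+ 2 * (s^-1 - 1) = s - s ^+ 2 by field; rewrite lt0r_neq0.
  by rewrite mulrnAr mulr2n; nra.
have h3 : s ^+ 2 * L <= s * L by rewrite ler_wpM2r// expr2; nra.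
rewrite mulrBr -mulrN; lra.
Qed.

Section hamming.
Context (R : realType) (K : finType).

(** A Chernoff bound: the number of w in the ball, times expR (- L rho V), is at
    most the sum over all w of expR (- L (distance to w0)), which factors over
    the vertices into the V-th power of 1 + (|K| - 1) expR (- L). *)
Lemma hamming_ball_card (gamma : R) : 0 < gamma ->
  exists2 rho : R, 0 < rho & forall (V : finType) (w0 : {ffun V -> K}),
    #|([set w : {ffun V -> K} |
        #|[pred v | w v != w0 v]|%:R <= rho * #|V|%:R])%SET|%:R
      <= expR (gamma * #|V|%:R).
Proof.
move=> g0; pose k : R := #|K|%:R; have k0 : 0 <= k by rewrite ler0n.
pose L := k * 2 / gamma.
have L0 : 0 <= L by rewrite divr_ge0 ?mulr_ge0// ltW.
have kL : k * expR (- L) <= gamma / 2.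
  rewrite expRN ler_pdivrMr ?expR_gt0//.
  apply: (@le_trans _ _ (gamma / 2 * (1 + L))); last first.
    by rewrite ler_pM2l ?divr_gt0// expR_ge1Dx.
  rewrite /L mulrDr mulr1.
  have -> : gamma / 2 * (k * 2 / gamma) = k by field; rewrite lt0r_neq0.
  by rewrite lerDr divr_ge0// ltW.
pose rho := gamma / (2 * (L + 1)).
have L1 : 0 < 2 * (L + 1) by lra.
have Lrho : L * rho <= gamma / 2.
  rewrite /rho mulrA ler_pdivrMr// mulrC; nra.
exists rho; first by rewrite divr_gt0.
move=> V w0; set B := [set w | _]%SET.
have key : #|B|%:R * expR (- (L * (rho * #|V|%:R))) <= expR (gamma / 2 * #|V|%:R).
  pose F (v : V) (a : K) : R := if a == w0 v then 1 else expR (- L).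
  have FE (w : {ffun V -> K}) : \prod_v F v (w v) =
      expR (- (L * #|[pred v | w v != w0 v]|%:R)).
    rewrite (bigID (fun v => w v == w0 v))/= big1 ?mul1r; last first.
      by move=> v /eqP ->; rewrite /F eqxx.
    rewrite (eq_bigr (fun=> expR (- L))); last by move=> v /negbTE h; rewrite /F h.
    by rewrite prodr_const -expRM_natr mulNr.
  have -> : #|B|%:R * expR (- (L * (rho * #|V|%:R))) =
      \sum_(w in B) expR (- (L * (rho * #|V|%:R))).
    by rewrite sumr_const mulr_natl.
  apply: (@le_trans _ _ (\sum_(w : {ffun V -> K}) \prod_v F v (w v))).
    rewrite [leRHS](bigID (mem B))/=.
    rewrite -[leLHS]addr0 lerD//; last first.
      apply: sumr_ge0 => w _; rewrite FE expR_ge0//.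
    apply: ler_sum => w; rewrite inE => h.
    by rewrite FE ler_expR lerN2 ler_wpM2l.
  rewrite -(bigA_distr_bigA F).
  apply: (@le_trans _ _ (\prod_(v : V) expR (gamma / 2))).
    apply: ler_prod => v _; apply/andP; split.
      by apply: sumr_ge0 => a _; rewrite /F; case: ifP => // _; rewrite expR_ge0.
    apply: (@le_trans _ _ (1 + k * expR (- L))).
      rewrite (bigD1 (w0 v))//= {1}/F eqxx lerD2l.
      rewrite (eq_bigr (fun=> expR (- L))); last by move=> a /negbTE h; rewrite /F h.
      rewrite sumr_const -[X in X <= _]mulr_natl ler_wpM2r ?expR_ge0//.
      by rewrite ler_nat max_card.
    apply: le_trans (expR_ge1Dx _); by rewrite lerD2l.
  by rewrite prodr_const -expRM_natr cardT -cardE.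
have : #|B|%:R <= expR (gamma / 2 * #|V|%:R) * expR (L * (rho * #|V|%:R)).
  by move: key; rewrite expRN ler_pdivrMr ?expR_gt0.
move=> /le_trans; apply; rewrite -expRD ler_expR mulrA -mulrDl ler_wpM2r//; lra.
Qed.

End hamming.

Section limsup.
Context (R : realType).
Implicit Types u v : (\bar R)^nat.
Local Open Scope ereal_scope.

Lemma le_ereal_real_below (x y : \bar R) :
  (forall r : R, r%:E < x -> r%:E <= y) -> x <= y.
Proof.
move=> h; rewrite leNgt; apply/negP => yx.
move: x y yx h => [r| |] [s| |]//= yx h.
- have := h ((r + s) / 2)%R; rewrite !lte_fin lee_fin => /(_ _).
  by rewrite lte_fin in yx => h'; have := h' ltac:(lra); lra.
- by have := h (r - 1)%R; rewrite lte_fin ltrBlDr ltrDl ltr01 leeNy_eq => /(_ isT).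
- by have := h (s + 1)%R (ltry _); rewrite lee_fin; lra.
- by have := h 0%R (ltry _); rewrite leeNy_eq.
Qed.

Lemma limn_esup_leD u v (c : R) : (\forall n \near \oo, u n <= v n + c%:E) ->
  limn_esup u <= limn_esup v + c%:E.
Proof.
move=> uv; rewrite -leeBlDr//; apply: le_ereal_inf_tmp => _ [A FA <-].
rewrite leeBlDr//.
apply: (@le_trans _ _ (ereal_sup (u @` (A `&` [set n | u n <= v n + c%:E])))).
  apply: ereal_inf_lbound; exists (A `&` [set n | u n <= v n + c%:E]) => //.
  exact: filterI.
apply: ge_ereal_sup => _ [n [An /= h] <-]; apply: (le_trans h).
by rewrite leeD2r//; apply: ereal_sup_ubound; exists n.
Qed.

Lemma limn_esup_le_near u (c : \bar R) : (\forall n \near \oo, u n <= c) ->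
  limn_esup u <= c.
Proof.
move=> uc; apply: (@le_trans _ _ (ereal_sup (u @` [set n | u n <= c]))).
  by apply: ereal_inf_lbound; exists [set n | u n <= c].
by apply: ge_ereal_sup => _ [n /= un <-].
Qed.

Lemma limn_esup_ge_freq u (c : \bar R) :
  (forall N, exists2 n, (N <= n)%N & c <= u n) -> c <= limn_esup u.
Proof.
move=> h; apply: le_ereal_inf_tmp => _ [A [N _ NA] <-].
have [n Nn cu] := h N; apply: le_trans cu _.
by apply: ereal_sup_ubound; exists n => //; exact: NA.
Qed.

Lemma limn_esup_gt_freq u (c : \bar R) : c < limn_esup u ->
  forall N, exists2 n, (N <= n)%N & c < u n.
Proof.
move=> cu N; apply/not_exists2P => h; move: cu; apply/negP; rewrite -leNgt.
apply: (@le_trans _ _ (ereal_sup (u @` [set n | (N <= n)%N]))).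
  by apply: ereal_inf_lbound; exists [set n | (N <= n)%N] => //; exists N.
apply: ge_ereal_sup => _ [n Nn <-]; rewrite leNgt; apply/negP => cun.
by case: (h n).
Qed.

End limsup.

(** * Names of configurations with respect to a finite partition *)

Section labels.
Context d (X : measurableType d) (K : finType) (lab : X -> K).

Definition cells : set (set X) := [set lab @^-1` [set k] | k in setT].

Definition name (V : finType) (x : config V X) : {ffun V -> K} :=
  [ffun v => lab (x v)].

End labels.

(** A partition is handled through the map sending a point to the index of its
    cell; cells of the power partition then become words over a finite
    alphabet. *)
Lemma partition_labels d (X : measurableType d) (P : set (set X)) :
  finite_measurable_partition P ->
  exists (K : finType) (lab : X -> K),
    [/\ P = cells lab, forall k, measurable (lab @^-1` [set k]) &
      forall k, exists x, lab x = k].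
Proof.
move=> [finP [covP trivP P0] mP].
have /choice[c cP] : forall x, exists C, P C /\ C x.
  by move=> x; have : cover P id x by [rewrite covP]; move=> [C PC Cx]; exists C.
have cin x : c x \in fset_set P by rewrite in_fset_set//; apply: mem_set; have [] := cP x.
pose lab x : fset_set P := [` cin x]%fset.
have Pk (k : fset_set P) : P (fsval k).
  have : fsval k \in fset_set P by exact: fsvalP.
  by rewrite in_fset_set// => /set_mem.
have labE k : lab @^-1` [set k] = fsval k.
  apply/seteqP; split => [x /= <-|x kx]; first by have [] := cP x.
  apply: val_inj => /=; apply: trivP => //; first by have [] := cP x.
  by exists x; split => //; have [] := cP x.
exists (fset_set P), lab; split.
- apply/seteqP; split => [C PC|_ [k _ <-]]; last by rewrite labE.
  have Cin : C \in fset_set P by rewrite in_fset_set// mem_set.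
  by exists [` Cin]%fset => //; rewrite labE.
- by move=> k; rewrite labE; exact: mP.
- move=> k; have [x kx] := P0 _ (Pk k); exists x.
  by have : (lab @^-1` [set k]) x by rewrite labE.
Qed.

Lemma fsbig_finset (T : Type) (idx : T) (op : Monoid.com_law idx) (I : finType)
    (S : {set I}) (F : I -> T) :
  \big[op/idx]_(i \in [set` S]) F i = \big[op/idx]_(i in S) F i.
Proof.
have -> : [set` S] = [set` enum S] by apply/seteqP; split => i /=; rewrite mem_enum.
by rewrite -fsbig_seq ?enum_uniq// big_enum.
Qed.

Section names.
Context (R : realType) d (X : metricMeasurableType R d) (K : finType) (lab : X -> K).
Hypothesis mlab : forall k, measurable (lab @^-1` [set k]).
Hypothesis slab : forall k, exists x, lab x = k.
Context (V : finType).
Local Notation nm := (@name d X K lab V).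
Local Notation W := {ffun V -> K}.
Implicit Types nu : Prob (config V X) R.

Lemma measurable_name (A : set W) : measurable (nm @^-1` A).
Proof.
have m1 w : measurable (nm @^-1` [set w]).
  have -> : nm @^-1` [set w] =
      \bigcap_(v in [set: V]) [set x : config V X | lab (x v) = w v].
    apply/seteqP; split => [x /= <- v _ /=|x h]; first by rewrite ffunE.
    by apply/ffunP => v; rewrite ffunE; exact: h.
  apply: fin_bigcap_measurable => // v _.
  have := @measurable_coord V d X v measurableT _ (mlab (w v)).
  by rewrite setTI.
have -> : nm @^-1` A = \bigcup_(w in A) (nm @^-1` [set w]).
  apply/seteqP; split => [x Ax|x [w Aw xw]]; first by exists (nm x).
  by rewrite /= xw.
by apply: fin_bigcup_measurable => // w _; exact: m1.
Qed.

Definition word_mass nu (w : W) : R := fine (nu (nm @^-1` [set w])).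

Lemma word_mass_sum nu (S : {set W}) :
  \sum_(w in S) word_mass nu w = fine (nu (nm @^-1` [set` S])).
Proof.
have -> : nm @^-1` [set` S] = \bigcup_(w in [set` S]) (nm @^-1` [set w]).
  apply/seteqP; split => [x Sx|x [w Sw xw]]; first by exists (nm x).
  by rewrite /= xw.
rewrite measure_fin_bigcup//=; last 2 first.
- by move=> w w' _ _ [x [/= <- <-]].
- by move=> w _; exact: measurable_name.
rewrite fsbig_finset (eq_bigr (fun w => (word_mass nu w)%:E)) ?sumEFin//.
by move=> w _; rewrite fineK ?fin_num_measure//; exact: measurable_name.
Qed.

Lemma word_mass_ge0 nu w : 0 <= word_mass nu w.
Proof. by rewrite /word_mass fine_ge0. Qed.

Lemma word_mass_sum1 nu : \sum_w word_mass nu w = 1.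
Proof.
have : \sum_w word_mass nu w = \sum_(w in [set: W]%SET) word_mass nu w.
  by apply: eq_bigl => w; rewrite inE.
move=> ->; rewrite word_mass_sum (_ : _ @^-1` _ = setT) ?probability_setT//.
by apply/seteqP; split => // x _ /=; rewrite inE.
Qed.

Lemma power_partition_cells :
  power_partition V (cells lab) = [set nm @^-1` [set w] | w in setT].
Proof.
apply/seteqP; split => [_ [F FP <-]|_ [w _ <-]].
  have /choice[w wF] : forall v, exists k, F v = lab @^-1` [set k].
    by move=> v; have [k _ <-] := FP v; exists k.
  exists (finfun w) => //; apply/seteqP; split => x /=.
    by move=> xw v; rewrite wF/= -[RHS](ffunE w) -xw ffunE.
  by move=> h; apply/ffunP => v; rewrite !ffunE; have := h v; rewrite wF.
exists (fun v => lab @^-1` [set w v]); first by move=> v; exists (w v).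
apply/seteqP; split => x /=; first by move=> h; apply/ffunP => v; rewrite ffunE; exact: h.
by move=> <- v; rewrite ffunE.
Qed.

Lemma name_surj w : exists x, nm x = w.
Proof.
have /choice[s sE] := slab.
by exists (fun v => s (w v)); apply/ffunP => v; rewrite ffunE sE.
Qed.

Lemma name_cell_inj : injective (fun w => nm @^-1` [set w]).
Proof.
move=> w w' ww'; have [x xw] := name_surj w.
have : (nm @^-1` [set w]) x by [].
by rewrite ww' /= xw.
Qed.

Lemma shannon_entropy_names nu :
  shannon_entropy nu (power_partition V (cells lab)) = entropy (word_mass nu).
Proof.
rewrite /shannon_entropy /entropy power_partition_cells; congr (- _).
rewrite fsbig_image; last by move=> w w' _ _; exact: name_cell_inj.
have -> : [set: W] = [set` [set: W]%SET] by apply/seteqP; split => w //=; rewrite inE.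
by rewrite fsbig_finset; apply: eq_bigl => w; rewrite inE.
Qed.

Lemma cov_partition_le nu (eps : R) (S : {set W}) :
  1 - eps < \sum_(w in S) word_mass nu w ->
  (cov_partition eps nu (power_partition V (cells lab)) <= #|S|%:R%:E)%E.
Proof.
move=> hS.
pose Q1 := [fset nm @^-1` [set w] | w in S]%fset.
apply: (@le_trans _ _ (#|` Q1|)%:R%:E); last first.
  by rewrite lee_fin ler_nat cardE leq_imfset_card.
apply: ereal_inf_lbound; exists Q1 => //; split.
  move=> C /=; rewrite power_partition_cells => /imfsetP[w _ ->].
  by exists w.
move: hS; rewrite word_mass_sum -lte_fin fineK ?fin_num_measure//; last first.
  exact: measurable_name.
move/lt_le_trans; apply; rewrite (_ : \bigcup_(C in _) C = nm @^-1` [set` S])//.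
apply/seteqP; split => [x [C /= /imfsetP[w wS ->] xw]|x xS].
  by rewrite /= xw.
by exists (nm @^-1` [set nm x]) => //=; apply: in_imfset.
Qed.

(** The infimum is attained: it ranges over cardinals of subsets of a finite
    set. *)
Lemma cov_partition_ex nu (eps : R) : 0 < eps ->
  exists2 S : {set W}, 1 - eps < \sum_(w in S) word_mass nu w &
    cov_partition eps nu (power_partition V (cells lab)) = #|S|%:R%:E.
Proof.
move=> eps0.
pose good (S : {set W}) := `[< 1 - eps < \sum_(w in S) word_mass nu w >].
have goodT : good [set: W]%SET.
  apply/asboolP; rewrite (_ : \sum_(w in _) _ = 1) ?ltrBlDr ?ltrDl//.
  by rewrite -(word_mass_sum1 nu); apply: eq_bigl => w; rewrite inE.
have [S /asboolP gS minS] := arg_minnP (fun S : {set W} => #|S|) goodT.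
exists S => //; apply/eqP; rewrite eq_le cov_partition_le//=.
apply: le_ereal_inf_tmp => _ [Q1 [Q1P hQ1] <-].
rewrite lee_fin ler_nat.
pose S1 : {set W} := ([set w | nm @^-1` [set w] \in Q1])%SET.
have S1Q1 : (#|S1| <= #|` Q1|)%N.
  have u : uniq [seq nm @^-1` [set w] | w <- enum S1].
    by rewrite map_inj_uniq ?enum_uniq//; exact: name_cell_inj.
  have := uniq_leq_size u (s2 := Q1); rewrite size_map -cardE; apply.
  by move=> C /mapP[w]; rewrite mem_enum inE => wQ ->.
apply: (leq_trans _ S1Q1); apply: minS; apply/asboolP.
rewrite word_mass_sum -lte_fin fineK ?fin_num_measure//; last exact: measurable_name.
apply: (lt_le_trans hQ1); rewrite (_ : \bigcup_(C in _) C = nm @^-1` [set` S1])//.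
apply/seteqP; split => [x [C /= CQ Cx]|x xS].
  have := Q1P _ CQ; rewrite power_partition_cells => -[w _ wC].
  by move: Cx CQ; rewrite -wC /= => <-; rewrite inE.
by exists (nm @^-1` [set nm x]) => //=; move: xS; rewrite /= inE.
Qed.

End names.

(** * Vertices close to the boundary of the partition *)

Section inradius.
Context (R : realType) d (X : metricMeasurableType R d) (K : finType) (lab : X -> K).

Lemma lipschitz_continuous (f : X -> R) :
  (forall a b, f a <= f b + mdist a b) -> continuous f.
Proof.
move=> lf a; apply/cvgrPdist_lt => e e0.
have : nbhs a (ball a e) by exact: nbhsx_ballx.
apply: filterS => b; rewrite ballEmdist/= => abe.
have h1 := lf a b; have h2 := lf b a.
rewrite metric_sym in h2.
by rewrite ltr_norml; apply/andP; split; lra.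
Qed.

(** The distance from a point to the complement of its own cell; adding 1 to the
    set makes the infimum meaningful when the cell is the whole space. *)
Definition inradius (a : X) : R :=
  inf ([set 1] `|` [set mdist a b | b in [set b | lab b != lab a]]).

Let inradius_lb a : lbound ([set 1] `|` [set mdist a b | b in [set b | lab b != lab a]]) 0.
Proof. by move=> _ [->|[b _ <-]]; [exact: ler01|exact: mdist_ge0]. Qed.

Lemma inradius_ge0 a : 0 <= inradius a.
Proof. by apply: lb_le_inf; [exists 1; left|exact: inradius_lb]. Qed.

Lemma inradius_le1 a : inradius a <= 1.
Proof. by apply: ge_inf; [exists 0; exact: inradius_lb|left]. Qed.

Lemma inradius_le a b : lab b != lab a -> inradius a <= mdist a b.
Proof. by move=> ab; apply: ge_inf; [exists 0; exact: inradius_lb|right; exists b]. Qed.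

Lemma inradius_ge a c : c <= 1 -> (forall b, lab b != lab a -> c <= mdist a b) ->
  c <= inradius a.
Proof.
move=> c1 hc; apply: lb_le_inf; first by exists 1; left.
by move=> _ [->//|[b ab <-]]; exact: hc.
Qed.

Lemma inradius_lip a b : lab a = lab b -> inradius a <= inradius b + mdist a b.
Proof.
move=> ab; rewrite -lerBlDr; apply: inradius_ge.
  by rewrite lerBlDr (le_trans (inradius_le1 a))// lerDl mdist_ge0.
move=> b' b'b; rewrite lerBlDr addrC (le_trans _ (metric_triangle _ b _))//.
by apply: inradius_le; rewrite ab.
Qed.

(** Across two cells each of the two values is at most the distance of the two
    points, so the function is 1-Lipschitz on the whole space although it
    depends on the partition. *)
Lemma inradius_continuous : continuous inradius.
Proof.
apply: lipschitz_continuous => a b; have [ab|ab] := eqVneq (lab a) (lab b).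
  exact: inradius_lip.
by rewrite ler_wpDl ?inradius_ge0// inradius_le// eq_sym.
Qed.

Definition cell_radius (k : K) (a : X) : R := if lab a == k then inradius a else 0.

Lemma cell_radius_ge0 k a : 0 <= cell_radius k a.
Proof. by rewrite /cell_radius; case: ifP => // _; exact: inradius_ge0. Qed.

Lemma cell_radius_continuous k : continuous (cell_radius k).
Proof.
apply: lipschitz_continuous => a b; rewrite /cell_radius.
have [ak|ak] := eqVneq (lab a) k; have [bk|bk] := eqVneq (lab b) k.
- by apply: inradius_lip; rewrite ak bk.
- by rewrite add0r inradius_le// ak.
- by rewrite addr_ge0 ?inradius_ge0 ?mdist_ge0.
- by rewrite add0r mdist_ge0.
Qed.

Lemma inradius_boundary a : inradius a = 0 -> boundary (lab @^-1` [set lab a]) a.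
Proof.
move=> ra; split; first by apply: subset_closure.
rewrite /interior -nbhs_ballE => -[e /= e0 ea].
have : Num.min 1 e <= inradius a.
  apply: inradius_ge; first by rewrite ge_min lexx.
  move=> b ab; rewrite ge_min; apply/orP; right; rewrite leNgt; apply/negP => h.
  have : ball a e b by rewrite ballEmdist.
  by move=> /ea /= /eqP; rewrite (negbTE ab).
by rewrite ra leNgt lt_min ltr01 e0.
Qed.

End inradius.

Lemma vmean_perm (R : realType) (V : finType) (s : {perm V}) (F : V -> R) :
  vmean (fun v => F (s v)) = vmean F.
Proof. by rewrite /vmean [in RHS](reindex_inj (@perm_inj _ s)). Qed.

Section coord_mean.
Context (R : realType) (V : finType) d (X : topMeasurableType d).

Definition coord_mean (f : X -> R) (x : config V X) : R := vmean (fun v => f (x v)).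

Lemma measurable_coord_mean_lt (bX : measurable_base X) (f : X -> R) (a : R) :
  continuous f -> measurable [set x : config V X | coord_mean f x < a].
Proof.
move=> cf.
have cm : continuous (coord_mean f).
  apply: continuous_mulr; first exact: continuous_constr.
  apply: continuous_sumr => v.
  exact: (continuous_compr (@config_coord_continuous V _ X v) cf).
have bV : measurable_base (config V X).
  by apply: config_measurable_base => //; exact: countableP.
have /(measurable_continuous bV) mm := cm.
by have := mm measurableT _ (measurable_itv `]-oo, a[); rewrite setTI set_itvE.
Qed.

End coord_mean.

Section bump.
Context (R : realType) (G : groupType) (countableG : countable [set: G]).
Context (V : nat -> finType) (V_gt0 : forall n, (0 < #|V n|)%N).
Context (sigma : forall n, G -> {perm V n}).
Context d (X : topMeasurableType d).
Hypotheses (bX : measurable_base X) (cX : compact [set: X]).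
Variables (mu : Prob (config G X) R) (mus : forall n, Prob (config (V n) X) R).
Hypothesis hlde : lde_cvg V_gt0 sigma mus mu.

Let bG : measurable_base (config G X).
Proof. exact: config_measurable_base. Qed.
Let cG : compact [set: config G X].
Proof. exact: config_compact. Qed.

(** A function that is positive almost everywhere is small at few vertices only.
    The conclusion is phrased with a continuous majorant f of the indicator of
    q < c, since convergence is tested on continuous functions. *)
Lemma bump_law (q : X -> R) (eta : R) : continuous q -> (forall a, 0 <= q a) ->
  mu [set x | q (x 1%g) = 0] = 0%E -> 0 < eta ->
  exists (c : R) (f : X -> R), [/\ 0 < c, continuous f, (forall a, 0 <= f a),
    (forall a, q a < c -> 1 <= f a) &
    whp (fun n => mus n) (fun n => [set x | coord_mean f x < eta])].
Proof.
move=> cq q0 muq eta0.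
have cq1 : continuous (fun x : config G X => q (x 1%g)).
  exact: (continuous_compr (@config_coord_continuous G _ X 1%g) cq).
pose S (k : nat) := [set x : config G X | q (x 1%g) < k.+1%:R^-1].
have mS k : measurable (S k).
  have /(measurable_continuous bG) mm := cq1.
  by have := mm measurableT _ (measurable_itv `]-oo, k.+1%:R^-1[); rewrite setTI set_itvE.
have capS : \bigcap_k S k = [set x | q (x 1%g) = 0].
  apply/seteqP; split => [x Sx|x /= qx k _]; last by rewrite /S /= qx invr_gt0.
  apply/eqP; rewrite /= eq_le q0 andbT leNgt; apply/negP => qx.
  have [k kq] := ltr_add_invr qx; have := Sx k I; rewrite /S /= add0r in kq *.
  by rewrite ltNge (ltW kq).
have Scvg : mu (S k) @[k --> \oo] --> 0%E.
  rewrite -muq -capS; apply: nonincreasing_cvg_mu => //.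
  - by rewrite (le_lt_trans (probability_le1 mu (mS 0%N)))// ltry.
  - exact: bigcapT_measurable.
  - move=> i j ij; apply/subsetPset => x; rewrite /S/= => /lt_le_trans; apply.
    by rewrite lef_pV2 ?posrE// ler_nat ltnS.
have [k hk] : exists k, (mu (S k) < (eta / 4)%:E)%E.
  have e4 : 0 < eta / 4 by rewrite divr_gt0.
  have /fine_cvgP[_ /cvgrPdist_lt/(_ _ e4)[N _ hN]] := Scvg.
  exists N; have := hN N (leqnn N); rewrite sub0r normrN /= => h.
  rewrite -(@fineK _ (mu (S N))) ?fin_num_measure// lte_fin.
  exact: le_lt_trans (ler_norm _) h.
(* f is twice the positive part of g, hence at least 1 where g is at least 1/2,
   and it vanishes outside S k. *)
pose g a := 1 - k.+1%:R * q a.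
pose f a := g a + `|g a|.
have cg : continuous g.
  apply: continuous_subr; first exact: continuous_constr.
  by apply: continuous_mulr => //; exact: continuous_constr.
have cf : continuous f by apply: continuous_addr => //; exact: continuous_normr.
have g1 a : g a <= 1 by rewrite /g gerBl mulr_ge0.
have f0 a : 0 <= f a by rewrite /f; have := ler_norm (- g a); rewrite normrN; lra.
have f2 a : f a <= 2.
  by rewrite /f; case: (ger0P (g a)); have := g1 a; lra.
exists (k.+1%:R *+ 2)^-1, f; split => //.
- move=> a qa.
  have : k.+1%:R * q a < 2^-1.
    have -> : 2^-1 = k.+1%:R * (k.+1%:R *+ 2)^-1 :> R.
      have kn : k.+1%:R != 0 :> R by rewrite pnatr_eq0.
      by move: kn; set r := k.+1%:R => kn; rewrite -mulr_natr; field.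
    by rewrite ltr_pM2l.
  by rewrite /f => h; have := ler_norm (g a); rewrite /g in h *; lra.
have cf1 : continuous (fun x : config G X => f (x 1%g)).
  exact: (continuous_compr (@config_coord_continuous G _ X 1%g) cf).
have intf : \int[mu]_x f (x 1%g) < eta / 2.
  have mSC := measurableC (mS k).
  have := @Rintegral_le_outside _ _ _ bG cG mu _ (~` S k) 0 2 cf1 mSC (lexx _) (ler0n _ _).
  move=> /(_ (fun x => f2 _)) h.
  have : \int[mu]_x f (x 1%g) <= 0 + 2 * (1 - fine (mu (~` S k))).
    apply: h => x /negP; rewrite -leNgt => hq.
    have : g (x 1%g) <= 0.
      by rewrite /g subr_le0 -ler_pdivrMl ?ltr0n// mulr1.
    by rewrite /f => gn; rewrite ler0_norm// subrr.
  rewrite probability_setC// fineB ?fin_num_measure//= => h1.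
  have h2 : fine (mu (S k)) < eta / 4.
    by rewrite -lte_fin fineK ?fin_num_measure.
  lra.
have := lde_law countableG bX cX hlde cf1 (divr_gt0 eta0 (ltr0n _ 2)).
move=> h e e0; have := h e e0; apply: filterS => n; move/lt_le_trans; apply.
apply: le_measure.
- by apply: mem_set; apply: (@law_measurable R G V sigma d X bX n (fun x => f (x 1%g))).
- by apply: mem_set; exact: measurable_coord_mean_lt.
move=> x /=; rewrite /pullback (vmean_perm (sigma n 1%g) (fun v => f (x v))).
by rewrite ltr_norml /coord_mean => /andP[_ ?]; lra.
Qed.

End bump.

Lemma inradius_null (R : realType) (G : groupType) d (X : metricMeasurableType R d)
    (borelX : @measurable d X = <<s @open X >>)
    (K : finType) (lab : X -> K) (mu : Prob (config G X) R) :
  (forall k, mu [set x : config G X | boundary (lab @^-1` [set k]) (x 1%g)] = 0%E) ->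
  mu [set x | inradius lab (x 1%g) = 0] = 0%E.
Proof.
move=> hb.
pose B k := [set x : config G X | boundary (lab @^-1` [set k]) (x 1%g)].
have mB k : measurable (B k).
  have mb : measurable (boundary (lab @^-1` [set k] : set X)).
    have mo (U : set X) : open U -> measurable U.
      by move=> oU; rewrite borelX; exact: sub_gen_smallest.
    apply: measurableD; last by apply: mo; exact: open_interior.
    by rewrite -[X in measurable X]setCK; apply/measurableC/mo/closed_openC/closed_closure.
  by have := @measurable_coord G d X 1%g measurableT _ mb; rewrite setTI.
have mr : measurable [set x : config G X | inradius lab (x 1%g) = 0].
  have m0 : measurable [set a | inradius lab a = 0].
    have mo (U : set X) : open U -> measurable U.
      by move=> oU; rewrite borelX; exact: sub_gen_smallest.
    rewrite -[X in measurable X]setCK; apply/measurableC/mo.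
    have /continuousP/(_ (~` [set 0 : R])) := @inradius_continuous R d X K lab.
    apply; exact: (closed_openC (@closed_eq _ (0 : R))).
  by have := @measurable_coord G d X 1%g measurableT _ m0; rewrite setTI.
apply: measure_negligible => //.
apply: (@negligibleS _ _ _ mu (\big[setU/set0]_k B k)).
  move=> x /= /inradius_boundary hx; rewrite (bigD1 (lab (x 1%g)))//=.
  by left.
apply: (big_ind (fun A => mu.-negligible A)).
- exact: negligible_set0.
- exact: negligibleU.
- by move=> k _; apply/(negligibleP _ (mB k)); exact: hb.
Qed.

(** * Metric coverings versus coverings by cells *)

Lemma probability_setI_gt d (T : measurableType d) (R : realType)
    (P : probability T R) (A B : set T) (a b : R) :
  measurable A -> measurable B -> ((1 - a)%:E < P A)%E -> ((1 - b)%:E < P B)%E ->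
  ((1 - (a + b))%:E < P (A `&` B))%E.
Proof.
move=> mA mB; have mAB : measurable (A `&` B) by exact: measurableI.
have := measureU2 P (measurableC mA) (measurableC mB).
rewrite -setCI/= !probability_setC//.
rewrite -(@fineK _ (P A)) ?fin_num_measure// -(@fineK _ (P B)) ?fin_num_measure//.
rewrite -(@fineK _ (P (A `&` B))) ?fin_num_measure//.
rewrite -!EFinB -EFinD lee_fin !lte_fin; lra.
Qed.

Lemma card_has_le (R : realType) (T : finType) (I : Type) (B : I -> {set T})
    (M : R) (s : seq I) : (forall i, #|B i|%:R <= M) ->
  #|[set w | has (fun i => w \in B i) s]%SET|%:R <= (size s)%:R * M.
Proof.
move=> BM; elim: s => [|i s IHs].
  rewrite mul0r (_ : #|_| = 0%N)//; apply/eqP; rewrite cards_eq0; apply/eqP/setP => w.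
  by rewrite !inE.
apply: (@le_trans _ _ (#|B i| + #|[set w | has (fun i => w \in B i) s]%SET|)%:R).
  rewrite ler_nat (leq_trans _ (leq_card_setU _ _))// subset_leq_card//.
  by apply/fintype.subsetP => w; rewrite !inE.
by rewrite natrD [(size (i :: s))%:R]mulrS mulrDl mul1r lerD.
Qed.

Section config_metric.
Context (R : realType) d (X : metricMeasurableType R d) (V : finType).
Hypotheses (bX : measurable_base X).
Hypothesis V_gt0 : (0 < #|V|)%N.

Lemma mdist_continuous (a : X) : continuous (fun b : X => mdist a b).
Proof.
apply: lipschitz_continuous => b c.
by rewrite [mdist b c]metric_sym; exact: metric_triangle.
Qed.

Lemma config_distE (x y : config V X) :
  config_dist x y = vmean (fun v => mdist (x v) (y v)).
Proof. by []. Qed.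

Lemma measurable_config_ball (c : config V X) (delta : R) :
  measurable [set y : config V X | config_dist c y < delta].
Proof.
have cm : continuous (fun y : config V X => config_dist c y).
  apply: continuous_mulr; first exact: continuous_constr.
  apply: continuous_sumr => v.
  exact: (continuous_compr (@config_coord_continuous V _ X v) (@mdist_continuous (c v))).
have bV : measurable_base (config V X).
  by apply: config_measurable_base => //; exact: countableP.
have /(measurable_continuous bV) mm := cm.
by have := mm measurableT _ (measurable_itv `]-oo, delta[); rewrite setTI set_itvE.
Qed.

Lemma measurable_config_balls (s : seq (config V X)) (delta : R) :
  measurable (\bigcup_(c in [set` s]) [set y | config_dist c y < delta]).
Proof.
apply: fin_bigcup_measurable; first exact: finite_seq.
by move=> c _; exact: measurable_config_ball.
Qed.

Context (K : finType) (lab : X -> K).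
Hypothesis mlab : forall k, measurable (lab @^-1` [set k]).
Hypothesis slab : forall k, exists x, lab x = k.
Implicit Types nu : Prob (config V X) R.

Lemma cov_metric_le_partition nu (eps delta : R) : 0 < eps ->
  (forall C, cells lab C -> (diam C < delta%:E)%E) ->
  (cov_metric eps delta nu <= cov_partition eps nu (power_partition V (cells lab)))%E.
Proof.
move=> eps0 hdiam.
have [S hS ->] := cov_partition_ex mlab slab nu eps0.
have /choice[pt ptE] : forall w : {ffun V -> K}, exists x : config V X, name lab x = w.
  by move=> w; exact: name_surj.
rewrite cardE -(size_map pt); apply: ereal_inf_lbound.
exists [seq pt w | w <- enum S] => //=.
move: hS; rewrite word_mass_sum// -lte_fin fineK ?fin_num_measure//; last first.
  exact: measurable_name.
move/lt_le_trans; apply; apply: le_measure.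
- by apply: mem_set; exact: measurable_name.
- by apply: mem_set; exact: measurable_config_balls.
move=> x /= xS; exists (pt (name lab x)).
  by apply: map_f; rewrite mem_enum.
rewrite /= config_distE /vmean mulrC ltr_pdivrMr ?ltr0n// mulr_natr -sumr_const.
apply: ltr_sum => [|v _]; first by apply/hasP; exists (enum_val (Ordinal V_gt0)); rewrite ?mem_index_enum.
have := hdiam (lab @^-1` [set lab (x v)]).
move=> /(_ _) h; rewrite -lte_fin; apply: le_lt_trans (h _); last by exists (lab (x v)).
apply: ereal_sup_ubound; exists (pt (name lab x) v, x v) => //=; split => //=.
by have /ffunP/(_ v) := ptE (name lab x); rewrite !ffunE.
Qed.

(** Two points in different cells are at distance at least the inradius of
    either; so a vertex where the names differ either has small inradius or
    contributes at least c to the distance. *)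
Lemma name_distance (x y : config V X) (f : X -> R) (c : R) : 0 < c ->
  (forall a, 0 <= f a) -> (forall a, inradius lab a < c -> 1 <= f a) ->
  #|[pred v | name lab y v != name lab x v]|%:R <=
    (coord_mean f x + config_dist x y / c) * #|V|%:R.
Proof.
move=> c0 f0 hf.
have VR : 0 < #|V|%:R :> R by rewrite ltr0n.
rewrite /coord_mean config_distE /vmean -mulrA -mulrDr mulrAC mulVf ?lt0r_neq0// mul1r.
rewrite mulr_suml -big_split/= -sum1_card natr_sum.
rewrite [leRHS](bigID (fun v => name lab y v != name lab x v))/=.
rewrite -[leLHS]addr0 lerD//.
  apply: ler_sum => v; rewrite inE !ffunE => yx.
  have hr := inradius_le yx.
  have [rc|cr] := ltP (inradius lab (x v)) c.
    by rewrite (le_trans (hf _ rc))// lerDl divr_ge0 ?mdist_ge0// ltW.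
  rewrite ler_wpDl// ler_pdivlMr// mul1r; exact: le_trans cr hr.
by apply: sumr_ge0 => v _; rewrite addr_ge0// divr_ge0 ?mdist_ge0// ltW.
Qed.

(** For each ball of the cover, one good configuration y in it is chosen; the
    names of all good configurations of the ball lie in the Hamming ball around
    the name of y. *)
Lemma cov_partition_le_balls nu (eps delta rho c E : R) (f : X -> R) :
  0 < rho -> 0 < c -> continuous f -> (forall a, 0 <= f a) ->
  (forall a, inradius lab a < c -> 1 <= f a) ->
  rho / 2 + 2 * delta / c <= rho ->
  (forall w0 : {ffun V -> K}, #|([set w : {ffun V -> K} |
        #|[pred v | w v != w0 v]|%:R <= rho * #|V|%:R])%SET|%:R <= E) ->
  ((1 - eps / 2)%:E < nu [set x | (coord_mean f x < rho / 2)%R])%E ->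
  (cov_partition eps nu (power_partition V (cells lab)) <=
    cov_metric (eps / 2) delta nu * E%:E)%E.
Proof.
move=> rho0 c0 cf f0 hf hrho hE hgood.
have E0 : 0 < E.
  pose w0 := name lab (fun=> point : X) : {ffun V -> K}.
  apply: lt_le_trans (hE w0); rewrite ltr0n card_gt0; apply/set0Pn; exists w0.
  rewrite inE (_ : #|_| = 0%N); last by apply: eq_card0 => v; rewrite !inE eqxx.
  by rewrite mulr_ge0// ltW.
rewrite -lee_pdivrMr//.
apply: le_ereal_inf_tmp => _ [s hs <-].
rewrite lee_pdivrMr// -EFinM.
pose good := [set x : config V X | coord_mean f x < rho / 2].
have mgood : measurable good by exact: measurable_coord_mean_lt.
have /choice[y yP] : forall c0 : config V X, exists y : config V X,
    forall x, good x -> config_dist c0 x < delta ->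
      good y /\ config_dist c0 y < delta.
  move=> c1; have [[y [gy yc]]|no] := pselect (exists y, good y /\ config_dist c1 y < delta).
    by exists y.
  by exists c1 => x gx xc; exfalso; apply: no; exists x.
pose B c1 : {set {ffun V -> K}} := [set w : {ffun V -> K} |
        #|[pred v | w v != name lab (y c1) v]|%:R <= rho * #|V|%:R]%SET.
pose S : {set {ffun V -> K}} := [set w | has (fun c1 => w \in B c1) s]%SET.
have hcard : #|S|%:R <= (size s)%:R * E.
  by apply: card_has_le => c1; exact: hE.
apply: le_trans (cov_partition_le mlab _) _; last by rewrite lee_fin; exact: hcard.
rewrite word_mass_sum// -lte_fin fineK ?fin_num_measure//; last exact: measurable_name.
have := probability_setI_gt mgood (measurable_config_balls s delta) hgood hs.
rewrite -splitr => /lt_le_trans; apply; apply: le_measure.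
- apply: mem_set; apply: measurableI => //; exact: measurable_config_balls.
- by apply: mem_set; exact: measurable_name.
move=> x [gx [c1 /= c1s xc1]]; rewrite inE; apply/hasP; exists c1 => //.
have [gy yc1] := yP c1 x gx xc1.
rewrite inE; apply: le_trans (name_distance _ _ c0 f0 hf) _.
rewrite ler_pM2r ?ltr0n//; apply: le_trans hrho.
apply: lerD; first exact: ltW.
rewrite ler_pM2r ?invr_gt0//.
have : config_dist (y c1) x <= config_dist c1 (y c1) + config_dist c1 x.
  rewrite !config_distE /vmean -mulrDr -big_split/= ler_wpM2l ?invr_ge0//.
  apply: ler_sum => v _; rewrite [mdist (c1 v) (y c1 v)]metric_sym.
  exact: metric_triangle.
lra.
Qed.

End config_metric.

(** * Asymptotic comparison of covering numbers and Shannon entropy *)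

Section rate.
Context (R : realType).
Implicit Types (a b : \bar R).
Local Open Scope ereal_scope.

Lemma le_lne a b : a <= b -> lne a <= lne b.
Proof.
move=> ab; have [a0|a0] := leP a 0; first by rewrite le0_lneNy// leNye.
rewrite lee_lne// in_itv/= leey andbT; first exact: ltW.
by rewrite (le_trans _ ab)// ltW.
Qed.

Definition rate (N : nat) a : \bar R := (N%:R^-1)%:E * lne a.

Lemma rate_le (N : nat) a b : a <= b -> rate N a <= rate N b.
Proof. by move=> ab; rewrite lee_wpmul2l ?lee_fin ?invr_ge0//; exact: le_lne. Qed.

Lemma rate_expR (N : nat) (g : R) : (0 < N)%N -> rate N (expR (g * N%:R))%:E = g%:E.
Proof.
move=> N0; rewrite /rate lne_EFin ?expR_gt0// expRK -EFinM mulrCA mulVf ?mulr1//.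
by rewrite pnatr_eq0 -lt0n.
Qed.

Lemma rateM_expR (N : nat) b (g : R) : (0 < N)%N -> 0 <= b ->
  rate N (b * (expR (g * N%:R))%:E) <= rate N b + g%:E.
Proof.
move=> N0; rewrite le_eqVlt => /predU1P[<-|b0].
  by rewrite mul0e /rate le0_lneNy// gt0_muleNy ?lte_fin ?invr_gt0 ?ltr0n// leNye.
rewrite /rate lneM ?in_itv/= ?b0 ?leey ?lte_fin ?expR_gt0//.
rewrite [(expR _ <= 0)%R]leNgt expR_gt0/= expRK muleDr// ?fin_num_adde_defl//.
by rewrite leeD2l// -EFinM mulrCA mulVf ?mulr1// pnatr_eq0 -lt0n.
Qed.

Lemma rate_gt (N : nat) (M : nat) (h : R) : (0 < N)%N ->
  h%:E < rate N M%:R%:E -> (expR (h * N%:R) < M%:R)%R.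
Proof.
move=> N0 hM; rewrite ltNge; apply/negP => Mh.
move: hM; apply/negP; rewrite -leNgt -(rate_expR h N0).
by apply: rate_le; rewrite lee_fin.
Qed.

End rate.

Section conditional.
Context d (T : measurableType d) (R : realType) (P : probability T R).
Context (E : set T) (mE : measurable E).

Definition conditional : probability T R := mnormalize (mrestr P mE) P.

Lemma conditionalE A : P E != 0%E ->
  conditional A = (P (A `&` E) * (fine (P E))^-1%:E)%E.
Proof.
move=> PE; rewrite /conditional/= /mnormalize/= /mrestr/= setTI (negbTE PE)/=.
by rewrite (lt_eqF (le_lt_trans (probability_le1 P mE) (ltry 1))).
Qed.

Lemma conditional_le (c : R) A : 0 < c -> (c%:E <= P E)%E -> measurable A ->
  (conditional A <= (c^-1)%:E * P A)%E.
Proof.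
move=> c0 cE mA.
have PE0 : P E != 0%E by rewrite gt_eqF// (lt_le_trans _ cE)// lte_fin.
have cf : c <= fine (P E) by rewrite -lee_fin fineK ?fin_num_measure.
rewrite conditionalE// muleC; apply: lee_pmul => //.
- by rewrite lee_fin invr_ge0 fine_ge0.
- by rewrite lee_fin lef_pV2 ?posrE// (lt_le_trans c0).
- apply: le_measure; [|exact: mem_set|exact: subIsetl].
  by apply: mem_set; exact: measurableI.
Qed.

End conditional.

Section asymptotics.
Context (R : realType) (G : groupType) (countableG : countable [set: G]).
Context (V : nat -> finType) (V_gt0 : forall n, (0 < #|V n|)%N).
Context (sigma : forall n, G -> {perm V n}).
Context d (X : metricMeasurableType R d).
Hypotheses (compactX : compact [set: X])
  (borelX : @measurable d X = <<s @open X >>).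
Variable mu : Prob (config G X) R.
Context (K : finType) (lab : X -> K).
Hypothesis mlab : forall k, measurable (lab @^-1` [set k]).
Hypothesis slab : forall k, exists x, lab x = k.
Hypothesis boundary0 : forall k,
  mu [set x : config G X | boundary (lab @^-1` [set k]) (x 1%g)] = 0%E.
Implicit Types mus : forall n, Prob (config (V n) X) R.
Local Notation PV n := (power_partition (V n) (cells lab)).

Let bX : measurable_base X.
Proof. exact: compact_measurable_base. Qed.
Let bG : measurable_base (config G X).
Proof. exact: config_measurable_base. Qed.
Let cG : compact [set: config G X].
Proof. exact: config_compact. Qed.

Let mlab1 k : measurable [set x : config G X | lab (x 1%g) = k].
Proof.
by have := @measurable_coord G d X 1%g measurableT _ (mlab k); rewrite setTI.
Qed.

Lemma measurable_coord_eq0 (f : X -> R) : continuous f ->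
  measurable [set x : config G X | f (x 1%g) = 0].
Proof.
move=> cf; have m0 : measurable [set a | f a = 0].
  rewrite -[X in measurable X]setCK; apply: measurableC.
  apply: (measurable_base_open bX).
  have /continuousP/(_ (~` [set 0 : R])) := cf.
  apply; exact: (closed_openC (@closed_eq _ (0 : R))).
by have := @measurable_coord G d X 1%g measurableT _ m0; rewrite setTI.
Qed.

Let measurable_inradius0 : measurable [set x : config G X | inradius lab (x 1%g) = 0].
Proof. by apply: measurable_coord_eq0; exact: inradius_continuous. Qed.

Let measurable_cell_radius0 k :
  measurable [set x : config G X | cell_radius lab k (x 1%g) = 0].
Proof. by apply: measurable_coord_eq0; exact: cell_radius_continuous. Qed.

Lemma cov_partition_metric mus (eps gamma : R) :
  lde_cvg V_gt0 sigma mus mu -> 0 < eps -> 0 < gamma ->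
  exists2 delta : R, 0 < delta &
    (limn_esup (fun n => rate #|V n| (cov_partition eps (mus n) (PV n))) <=
     limn_esup (fun n => rate #|V n| (cov_metric (eps / 2) delta (mus n))) + gamma%:E)%E.
Proof.
move=> hlde eps0 gamma0.
have [rho rho0 hrho] := hamming_ball_card K gamma0.
have [c [f [c0 cf f0 hf hgood]]] := bump_law countableG bX compactX hlde
  (@inradius_continuous R d X K lab) (@inradius_ge0 R d X K lab)
  (inradius_null borelX boundary0) (divr_gt0 rho0 (ltr0n _ 2)).
pose delta := c * rho / 4.
have delta0 : 0 < delta by rewrite !mulr_gt0.
exists delta => //; apply: limn_esup_leD.
have := hgood (eps / 2) (divr_gt0 eps0 (ltr0n _ 2)).
apply: filterS => n hn.
have hd : rho / 2 + 2 * delta / c <= rho.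
  by rewrite le_eqVlt; apply/orP; left; apply/eqP; rewrite /delta; field; rewrite lt0r_neq0.
have h := cov_partition_le_balls bX (V_gt0 n) mlab rho0 c0 cf f0 hf hd (hrho (V n)) hn.
apply: le_trans (rate_le _ h) _; apply: rateM_expR => //.
by apply: le_ereal_inf_tmp => _ [s _ <-]; rewrite lee_fin.
Qed.

Lemma word_mass_bounds n (nu : Prob (config (V n) X) R) w :
  0 <= word_mass lab nu w <= 1.
Proof.
rewrite word_mass_ge0/= -lee_fin fineK ?fin_num_measure//; last exact: measurable_name.
by apply: probability_le1; exact: measurable_name.
Qed.

(** With high probability a configuration leaves the cell of full measure at few
    vertices, so one Hamming ball of names suffices. *)
Lemma cov_partition_full_cell mus (eps : R) (k0 : K) :
  lde_cvg V_gt0 sigma mus mu -> 0 < eps ->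
  mu [set x : config G X | lab (x 1%g) <> k0] = 0%E ->
  (limn_esup (fun n => rate #|V n| (cov_partition eps (mus n) (PV n))) <= 0)%E.
Proof.
move=> hlde eps0 muk0.
have muq : mu [set x : config G X | cell_radius lab k0 (x 1%g) = 0] = 0%E.
  have mr : measurable [set x : config G X | inradius lab (x 1%g) = 0].
    exact: measurable_inradius0.
  apply: measure_negligible; first exact: measurable_cell_radius0.
  apply: (@negligibleS _ _ _ mu
    ([set x : config G X | lab (x 1%g) <> k0] `|`
     [set x : config G X | inradius lab (x 1%g) = 0])).
    move=> x /=; rewrite /cell_radius; have [->|/eqP] := eqVneq (lab (x 1%g)) k0.
      by right.
    by left.
  apply: negligibleU.
    apply/negligibleP => //; rewrite (_ : [set x | _] = ~` [set x | lab (x 1%g) = k0])//.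
    exact: measurableC.
  by apply/negligibleP => //; exact: (inradius_null borelX boundary0).
apply/lee_addgt0Pr => gamma gamma0; rewrite add0e.
have [rho rho0 hrho] := hamming_ball_card K gamma0.
have [c [f [c0 cf f0 hf hgood]]] := bump_law countableG bX compactX hlde
  (@cell_radius_continuous R d X K lab k0) (@cell_radius_ge0 R d X K lab k0) muq rho0.
apply: limn_esup_le_near; have := hgood eps eps0; apply: filterS => n hn.
rewrite -(rate_expR gamma (V_gt0 n)); apply: rate_le.
pose w0 : {ffun V n -> K} := [ffun=> k0].
pose S : {set {ffun V n -> K}} := [set w : {ffun V n -> K} |
    #|[pred v | w v != w0 v]|%:R <= rho * #|V n|%:R]%SET.
apply: le_trans (_ : #|S|%:R%:E <= _)%E; last by rewrite lee_fin; exact: hrho.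
apply: cov_partition_le => //.
rewrite word_mass_sum// -lte_fin fineK ?fin_num_measure//; last exact: measurable_name.
apply: lt_le_trans hn _; apply: le_measure.
- by apply: mem_set; exact: measurable_coord_mean_lt.
- by apply: mem_set; exact: measurable_name.
move=> x /= hx; rewrite inE.
apply: (@le_trans _ _ (coord_mean f x * #|V n|%:R)); last first.
  by rewrite ler_pM2r ?ltr0n// ltW.
rewrite /coord_mean /vmean mulrAC mulVf ?mul1r; last by rewrite pnatr_eq0 -lt0n.
rewrite -sum1_card natr_sum [leRHS](bigID (fun v => name lab x v != w0 v))/=.
rewrite -[leLHS]addr0 lerD ?sumr_ge0//.
apply: ler_sum => v; rewrite inE !ffunE => hv; apply: hf.
by rewrite /cell_radius (negbTE hv).
Qed.

Lemma integral_cell_radius_gt0 (k : K) :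
  mu [set x : config G X | lab (x 1%g) = k] <> 0%E ->
  0 < \int[mu]_x cell_radius lab k (x 1%g).
Proof.
move=> muk.
pose f (x : config G X) := cell_radius lab k (x 1%g).
have cf : continuous f.
  exact: (continuous_compr (@config_coord_continuous G _ X 1%g) (@cell_radius_continuous R d X K lab k)).
have If := continuous_integrable bG cG mu cf.
rewrite lt_neqAle Rintegral_ge0 ?andbT; last by move=> x _; exact: cell_radius_ge0.
apply/eqP => int0; apply: muk.
have : (\int[mu]_x `|(f x)%:E| = 0)%E.
  under eq_integral do rewrite gee0_abs ?lee_fin ?cell_radius_ge0//.
  by rewrite -(RintegralE bG)// -int0.
move/(ae_eq_integral_abs mu measurableT (measurable_int _ If)) => [N [mN N0 hN]].
apply: measure_negligible => //.
apply: (@negligibleS _ _ _ mu (N `|` [set x : config G X | inradius lab (x 1%g) = 0])).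
  move=> x /= xk; have [r0|/eqP r0] := pselect (inradius lab (x 1%g) = 0); first by right.
  left; apply: hN => /= /(_ I) [].
  by rewrite /f /cell_radius xk eqxx => /eqP; rewrite (negbTE r0).
apply: negligibleU; first exact/negligibleP.
apply/negligibleP; first exact: measurable_inradius0.
exact: (inradius_null borelX boundary0).
Qed.

(** With high probability some vertex carries a point of the cell k in the first
    configuration and of the cell k' in the second.  Hence no word has large
    mass, whereas some word has mass at least |K|^(- V). *)
Lemma two_cells_diverge mus (k k' : K) :
  lde_cvg V_gt0 sigma mus mu -> k != k' ->
  mu [set x : config G X | lab (x 1%g) = k] <> 0%E ->
  mu [set x : config G X | lab (x 1%g) = k'] <> 0%E ->
  forall M : nat, \forall n \near \oo, (M < #|V n|)%N.
Proof.
move=> hlde kk' /integral_cell_radius_gt0 a0 /integral_cell_radius_gt0 b0 M.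
pose f (x : config G X) := cell_radius lab k (x 1%g).
pose g (x : config G X) := cell_radius lab k' (x 1%g).
have cf : continuous f.
  exact: (continuous_compr (@config_coord_continuous G _ X 1%g) (@cell_radius_continuous R d X K lab k)).
have cg : continuous g.
  exact: (continuous_compr (@config_coord_continuous G _ X 1%g) (@cell_radius_continuous R d X K lab k')).
have K0 : (0 < #|K|)%N by apply/card_gt0P; exists k.
(* If #|V n| <= M there are at most #|K| ^ M words, so one of them has mass at
   least the inverse, and e bounds the probability that it is drawn twice. *)
pose e : R := ((#|K| ^ M)%:R^-1) ^+ 2.
have e0 : 0 < e by rewrite exprn_gt0// invr_gt0 ltr0n expn_gt0 K0.
have := lde_product_law countableG bX compactX hlde cf cg (mulr_gt0 a0 b0) e0.
apply: filterS => n; set S := [set p | _] => hS.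
have mS : measurable S by exact: product_law_measurable.
rewrite ltnNge; apply/negP => VM.
pose W := {ffun V n -> K}.
have W0 : (0 : R) < #|W|%:R by rewrite ltr0n card_ffun expn_gt0 K0.
have [w hw] : exists w : W, #|W|%:R^-1 <= word_mass lab (mus n) w.
  apply/not_existsP => h.
  have : \sum_(w : W) word_mass lab (mus n) w < \sum_(w : W) #|W|%:R^-1.
    apply: ltr_sum.
      apply/hasP; exists (finfun (fun=> k)) => //; exact: mem_index_enum.
    by move=> w _; rewrite ltNge; apply/negP.
  by rewrite word_mass_sum1// sumr_const -[X in _ < X]mulr_natl divff ?ltxx// gt_eqF.
pose D := name lab (V := V n) @^-1` [set w].
have mD : measurable D by exact: measurable_name.
have SD : S `<=` ~` (D `*` D).
  move=> [x y] hxy [/= xw yw].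
  have fg0 v : f (pullback (sigma n) v x) * g (pullback (sigma n) v y) = 0.
    rewrite /f /g /pullback /cell_radius.
    have -> : lab (y (sigma n 1%g v)) = lab (x (sigma n 1%g v)).
      have /ffunP/(_ (sigma n 1%g v)) : name lab y = name lab x := etrans yw (esym xw).
      by rewrite !ffunE.
    have [->|] := eqVneq (lab (x (sigma n 1%g v))) k; last by rewrite mul0r.
    by rewrite (negbTE kk') mulr0.
  move: hxy; rewrite /S /vmean/= big1; last by move=> v _; exact: fg0.
  by rewrite mulr0 sub0r normrN ltNge => /negP; apply; exact: ler_norm.
have hD : ((mus n \x mus n) (D `*` D) = (word_mass lab (mus n) w ^+ 2)%:E)%E.
  rewrite product_measure1E// expr2 EFinM /word_mass fineK ?fin_num_measure//.
have : (1 - e < 1 - word_mass lab (mus n) w ^+ 2).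
  rewrite -lte_fin [X in (_ < X)%E]EFinB -hD -[X in (_ < X)%E]probability_setC//; last exact: measurableX.
  apply: lt_le_trans hS _; apply: le_measure => //; apply: mem_set => //.
  by apply: measurableC; exact: measurableX.
rewrite ltrD2l ltrN2 => hlt.
have : e <= word_mass lab (mus n) w ^+ 2.
  rewrite lerXn2r ?nnegrE ?word_mass_ge0 ?invr_ge0//.
  apply: le_trans hw; rewrite lef_pV2 ?posrE// ?ltr0n ?expn_gt0 ?K0//.
  by rewrite ler_nat card_ffun leq_pexp2l.
by rewrite leNgt hlt.
Qed.

Lemma entropy_le_cov mus (gamma : R) : 0 < gamma ->
  exists2 eps : R, 0 < eps &
   (limn_esup (fun n => (#|V n|%:R^-1 * shannon_entropy (mus n) (PV n))%:E) <=
    limn_esup (fun n => rate #|V n| (cov_partition eps (mus n) (PV n))) + gamma%:E)%E.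
Proof.
move=> gamma0.
have K0 : (0 < #|K|)%N by apply/card_gt0P; exists (lab point).
have L0 : 0 <= ln #|K|%:R :> R by rewrite ln_ge0// ler1n.
have [e /andP[e0 e1] he] := entropy_error L0 gamma0.
exists e => //; apply: limn_esup_leD; apply: nearW => n.
have [S hS ->] := cov_partition_ex mlab slab (mus n) e0.
rewrite shannon_entropy_names//.
have S0 : (0 < #|S|)%N.
  rewrite card_gt0; apply/eqP => S0; move: hS; rewrite S0 big_set0; lra.
have VR : 0 < #|V n|%:R :> R by rewrite ltr0n.
rewrite /rate lne_EFin ?ltr0n// -EFinM -EFinD lee_fin.
rewrite mulrC ler_pdivrMr// mulrDl mulrAC mulVf ?gt_eqF// mul1r.
have := @entropy_cover R _ _ S e (@word_mass_ge0 R d X K lab (V n) (mus n))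
  (word_mass_sum1 mlab (mus n)).
rewrite e0 e1 => /(_ isT hS) h; apply: le_trans h _.
rewrite card_ffun natrX lnXn ?ltr0n// -mulr_natl -addrA lerD2l.
apply: (@le_trans _ _ ((- ln (1 - e) + e * (ln #|K|%:R - ln e)) * #|V n|%:R)); last first.
  by rewrite ler_pM2r.
have h1 : 0 <= - ln (1 - e) by rewrite oppr_ge0 ln_le0//; lra.
have h2 : 0 <= e * - ln e by rewrite mulr_ge0 ?oppr_ge0 ?ln_le0// ltW.
have V1 : 1 <= #|V n|%:R :> R by rewrite ler1n.
have h3 := ler_wpM2l h1 V1; have h4 := ler_wpM2l h2 V1.
rewrite !mulr1 in h3 h4; rewrite mulrDl !mulrBr; rewrite mulrN in h4.
set A := ln #|K|%:R in L0 he *; nra.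
Qed.

Lemma shannon_entropy_ge0 n (nu : Prob (config (V n) X) R) :
  0 <= shannon_entropy nu (PV n).
Proof.
by rewrite shannon_entropy_names//; apply: entropy_ge0 => w; exact: word_mass_bounds.
Qed.

(** Conditioning on the union of the cells of mass less than expR (- h V) makes
    all atoms smaller than expR (- h V) / eps. *)
Lemma cov_le_entropy_diverge mus (eps : R) (C : \bar R) :
  lde_cvg V_gt0 sigma mus mu -> 0 < eps < 1 ->
  (forall M : nat, \forall n \near \oo, (M < #|V n|)%N) ->
  (forall nus, lde_cvg V_gt0 sigma nus mu ->
    limn_esup (fun n => (#|V n|%:R^-1 * shannon_entropy (nus n) (PV n))%:E) <= C)%E ->
  (limn_esup (fun n => rate #|V n| (cov_partition eps (mus n) (PV n))) <= C)%E.
Proof.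
move=> hlde /andP[eps0 eps1] Voo hC.
apply: le_ereal_real_below => h hlt.
apply/lee_addgt0Pr => gamma gamma0; rewrite -leeBlDr// -EFinB.
pose p n := word_mass lab (mus n).
pose light n : {set {ffun V n -> K}} :=
  [set w | p n w < expR (- (h * #|V n|%:R))]%SET.
pose E n := name lab (V := V n) @^-1` [set` light n].
have mE n : measurable (E n) by exact: measurable_name.
(* Conditioning takes place only where the event has mass at least eps, so
   that the whole sequence is dominated by eps^-1 times the original one. *)
pose nus n : Prob (config (V n) X) R :=
  if pselect (eps%:E <= mus n (E n))%E is left _ then conditional (mus n) (mE n)
  else mus n.
have nus_dom n A : measurable A -> (nus n A <= (eps^-1)%:E * mus n A)%E.
  move=> mA; rewrite /nus; case: pselect => [hE|_]; first exact: conditional_le.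
  by rewrite lee_pemull// lee_fin invf_ge1// ltW.
have eps1V : 0 < eps^-1 by rewrite invr_gt0.
have hnus := lde_dominated countableG bX compactX eps1V nus_dom hlde.
apply: le_trans (hC _ hnus); apply: limn_esup_ge_freq => N.
have le0 : 0 <= - ln eps / gamma.
  by rewrite divr_ge0 ?oppr_ge0 ?ln_le0// ltW.
have [N' _ hN'] := Voo (Num.bound (- ln eps / gamma)).
have [n Nn hn] := limn_esup_gt_freq hlt (maxn N N').
have /hN' Vn : (N' <= n)%N by rewrite (leq_trans _ Nn)// leq_maxr.
exists n; first by rewrite (leq_trans _ Nn)// leq_maxl.
have VR : 0 < #|V n|%:R :> R by rewrite ltr0n.
have hgV : - ln eps <= gamma * #|V n|%:R.
  rewrite mulrC -ler_pdivrMr//; apply: ltW; apply: (lt_trans (archi_boundP le0)).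
  by rewrite ltr_nat.
have p0 w : 0 <= p n w by exact: word_mass_ge0.
have p1 : \sum_w p n w = 1 by exact: word_mass_sum1.
(* A heavy word has mass at least expR (- h V), so there are at most
   expR (h V) of them, fewer than any cover of mass 1 - eps needs. *)
have hheavy : \sum_(w in ~: light n) p n w <= 1 - eps.
  rewrite leNgt; apply/negP => hS.
  have := cov_partition_le mlab hS => hcov.
  have := lt_le_trans hn (rate_le _ hcov) => /(rate_gt (V_gt0 n)).
  apply/negP; rewrite -leNgt.
  have : #|~: light n|%:R * expR (- (h * #|V n|%:R)) <= 1.
    rewrite -[leRHS]p1 mulr_natl -sumr_const [leRHS](bigID (mem (~: light n)))/=.
    rewrite -[leLHS]addr0 lerD ?sumr_ge0//.
    by apply: ler_sum => w; rewrite !inE -leNgt.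
  by rewrite expRN ler_pdivrMr ?expR_gt0// mul1r.
have hE : (eps%:E <= mus n (E n))%E.
  rewrite -[X in (_ <= X)%E]fineK; last by rewrite fin_num_measure//; exact: mE.
  rewrite lee_fin -word_mass_sum//.
  move: p1; rewrite (bigID (mem (light n)))/=.
  have -> : \sum_(w | w \notin light n) p n w = \sum_(w in ~: light n) p n w.
    by apply: eq_bigl => w; rewrite finset.in_setC.
  rewrite /p in hheavy *; lra.
have nusE : nus n = conditional (mus n) (mE n) by rewrite /nus; case: pselect.
rewrite lee_fin shannon_entropy_names// mulrC ler_pdivlMr//.
apply: (@le_trans _ _ (h * #|V n|%:R + ln eps)); first by lra.
apply: entropy_atoms.
- by move=> w; exact: word_mass_ge0.
- exact: word_mass_sum1.
move=> w; rewrite opprD expRD expRN [X in _ * X]expRN lnK ?posrE//.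
have mw : measurable (name lab (V := V n) @^-1` [set w]) by exact: measurable_name.
rewrite /word_mass nusE -lee_fin fineK ?fin_num_measure//.
have [wl|wl] := boolP (w \in light n).
  apply: le_trans (conditional_le (mE n) eps0 hE mw) _.
  rewrite -(@fineK _ (mus n _)) ?fin_num_measure// -EFinM lee_fin mulrC.
  by rewrite ler_pM2r// -expRN; move: wl; rewrite inE => /ltW.
rewrite conditionalE; last by rewrite gt_eqF// (lt_le_trans _ hE)// lte_fin.
rewrite (_ : _ `&` _ = set0).
  by rewrite measure0 mul0e lee_fin mulr_ge0 ?invr_ge0 ?expR_ge0// ltW.
apply/seteqP; split => // x [xw xl]; move: wl.
by rewrite -(xw : name lab x = w) (xl : name lab x \in light n).
Qed.

Lemma cov_le_entropy mus (eps : R) (C : \bar R) :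
  lde_cvg V_gt0 sigma mus mu -> 0 < eps < 1 ->
  (forall nus, lde_cvg V_gt0 sigma nus mu ->
    limn_esup (fun n => (#|V n|%:R^-1 * shannon_entropy (nus n) (PV n))%:E) <= C)%E ->
  (limn_esup (fun n => rate #|V n| (cov_partition eps (mus n) (PV n))) <= C)%E.
Proof.
move=> hlde epsb hC.
pose L k := [set x : config G X | lab (x 1%g) = k].
have mL k : measurable (L k) by exact: mlab1.
have [k0 hk0] : exists k, mu (L k) <> 0%E.
  apply/existsNP => h.
  have : mu setT = 0%E.
    apply: measure_negligible => //.
    apply: (@negligibleS _ _ _ mu (\big[setU/set0]_k L k)).
      by move=> x _; rewrite (bigD1 (lab (x 1%g)))//=; left.
    apply: (big_ind (fun A => mu.-negligible A)).
    - exact: negligible_set0.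
    - exact: negligibleU.
    - by move=> k _; apply/(negligibleP _ (mL k)); exact: h.
  by rewrite probability_setT => /eqP; rewrite onee_eq0.
have [[k [kk0 hk]]|no] := pselect (exists k, k != k0 /\ mu (L k) <> 0%E).
  apply: cov_le_entropy_diverge hC => //.
  exact: (two_cells_diverge hlde kk0 hk hk0).
apply: le_trans (_ : 0 <= C)%E.
  apply: (cov_partition_full_cell (k0 := k0)) => //; first by case/andP: epsb.
  have mNL : measurable [set x : config G X | lab (x 1%g) <> k0].
    by rewrite (_ : [set x | _] = ~` L k0)//; exact: measurableC.
  apply: measure_negligible => //.
  apply: (@negligibleS _ _ _ mu (\big[setU/set0]_(k | k != k0) L k)).
    by move=> x /= /eqP xk; rewrite (bigD1 (lab (x 1%g)))//=; left.
  apply: (big_ind (fun A => mu.-negligible A)).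
  - exact: negligible_set0.
  - exact: negligibleU.
  - move=> k kk0; apply/(negligibleP _ (mL k)).
    by apply: contrapT => hk; apply: no; exists k.
apply: le_trans (hC _ hlde); apply: limn_esup_ge_freq => N; exists N => //.
by rewrite lee_fin mulr_ge0 ?invr_ge0// shannon_entropy_ge0.
Qed.

End asymptotics.

(** * The two formulas for model-measure sofic entropy *)

Lemma cov_partition_antitone (R : realType) d (T : measurableType d)
    (nu : probability T R) (Q : set (set T)) (eps eps' : R) : eps <= eps' ->
  (cov_partition eps' nu Q <= cov_partition eps nu Q)%E.
Proof.
move=> ee'; apply: le_ereal_inf => _ [Q1 [Q1Q hQ1] <-]; exists Q1 => //; split => //.
by apply: le_lt_trans hQ1; rewrite lee_fin lerB.
Qed.

Theorem theoremB (R : realType) (G : groupType)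
  (countableG : countable [set: G])
  (V : nat -> finType) (V_gt0 : forall n, (0 < #|V n|)%N)
  (sigma : forall n, G -> {perm V n})
  (soficG : sofic_approximation R sigma)
  (d : measure_display) (X : metricMeasurableType R d)
  (compactX : compact [set: X])
  (borelX : @measurable d X = <<s @open X >>)
  (mu : Prob (config G X) R) (invmu : shift_invariant mu)
  (PP : set (set (set X)))
  (PPpart : forall P, PP P -> finite_measurable_partition P)
  (Pi : forall delta : R, 0 < delta ->
    exists2 P, PP P & forall C, P C -> (diam C < delta%:E)%E)
  (Pii : forall P, PP P -> forall C, P C ->
    mu [set x : config G X | boundary C (x 1%g)] = 0%E) :
  model_measure_entropy V_gt0 sigma mu =
    ereal_sup [set h : \bar R |
      exists (eps : R) (P : set (set X)) (ni : nat -> nat)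
        (mus : forall i, Prob (config (V (ni i)) X) R),
        [/\ 0 < eps, PP P, lde_subsequence V_gt0 sigma mu mus &
          h = limn_esup (fun i => ((#|V (ni i)|%:R^-1)%:E *
            lne (cov_partition eps (mus i)
                   (power_partition (V (ni i)) P)))%E)]]
  /\
  model_measure_entropy V_gt0 sigma mu =
    ereal_sup [set h : \bar R |
      exists (P : set (set X)) (ni : nat -> nat)
        (mus : forall i, Prob (config (V (ni i)) X) R),
        [/\ PP P, lde_subsequence V_gt0 sigma mu mus &
          h = limn_esup (fun i => (#|V (ni i)|%:R^-1 *
            shannon_entropy (mus i) (power_partition (V (ni i)) P))%:E)]].

Proof.
have bX : measurable_base X by exact: compact_measurable_base.
set B := ereal_sup [set h | exists (eps : R) P ni mus, _].
set C := ereal_sup [set h | exists P ni mus, _].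
have rateB eps P ni (mus : forall i, Prob (config (V (ni i)) X) R) :
    0 < eps -> PP P -> lde_subsequence V_gt0 sigma mu mus ->
    (limn_esup (fun i => rate #|V (ni i)|
      (cov_partition eps (mus i) (power_partition (V (ni i)) P))) <= B)%E.
  by move=> eps0 PPP hseq; apply: ereal_sup_ubound; exists eps, P, ni, mus.
have AB : (model_measure_entropy V_gt0 sigma mu <= B)%E.
  apply: ge_ereal_sup => _ [ni [mus [hseq ->]]].
  apply: ge_ereal_sup => _ [eps [delta [eps0 delta0 ->]]].
  have [P PPP hdiam] := Pi delta delta0.
  apply: le_trans (rateB eps P ni mus eps0 PPP hseq).
  have [K [lab [PE mlab slab]]] := partition_labels (PPpart P PPP).
  rewrite -[leRHS]adde0; apply: limn_esup_leD; apply: nearW => i; rewrite adde0.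
  apply: rate_le; rewrite PE; apply: cov_metric_le_partition => //.
  by rewrite -PE.
have BA : (B <= model_measure_entropy V_gt0 sigma mu)%E.
  apply: ge_ereal_sup => _ [eps [P [ni [mus [eps0 PPP hseq ->]]]]].
  have [K [lab [PE mlab slab]]] := partition_labels (PPpart P PPP).
  have bd k : mu [set x : config G X | boundary (lab @^-1` [set k]) (x 1%g)] = 0%E.
    by apply: (Pii P) => //; rewrite PE; exists k.
  apply/lee_addgt0Pr => gamma gamma0.
  have [delta delta0 h] := cov_partition_metric countableG compactX borelX mlab bd
    hseq.2 eps0 gamma0.
  rewrite PE; apply: le_trans h _; rewrite leeD2r//.
  apply: le_trans (ereal_sup_ubound _); last by exists ni, mus; split; [exact: hseq|].
  apply: ereal_sup_ubound; exists (eps / 2), delta; split => //.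
  exact: divr_gt0.
have CB : (C <= B)%E.
  apply: ge_ereal_sup => _ [P [ni [mus [PPP hseq ->]]]].
  have [K [lab [PE mlab slab]]] := partition_labels (PPpart P PPP).
  apply/lee_addgt0Pr => gamma gamma0.
  have [eps eps0 h] := entropy_le_cov (fun i => V_gt0 (ni i)) mlab slab mus gamma0.
  rewrite PE; apply: le_trans h _; rewrite leeD2r//.
  by rewrite -PE; exact: rateB.
have BC : (B <= C)%E.
  apply: ge_ereal_sup => _ [eps [P [ni [mus [eps0 PPP hseq ->]]]]].
  have [K [lab [PE mlab slab]]] := partition_labels (PPpart P PPP).
  have bd k : mu [set x : config G X | boundary (lab @^-1` [set k]) (x 1%g)] = 0%E.
    by apply: (Pii P) => //; rewrite PE; exists k.
  pose e := Num.min eps (2^-1).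
  have e01 : 0 < e < 1.
    by rewrite lt_min eps0 invr_gt0 ltr0n/= gt_min invf_lt1 ?ltr1n ?orbT.
  have ee : e <= eps by rewrite ge_min lexx.
  apply: (@le_trans _ _ (limn_esup (fun i => rate #|V (ni i)|
      (cov_partition e (mus i) (power_partition (V (ni i)) P))))).
    rewrite -[leRHS]adde0; apply: limn_esup_leD; apply: nearW => i; rewrite adde0.
    by apply: rate_le; exact: cov_partition_antitone.
  rewrite PE; apply: (cov_le_entropy countableG compactX borelX mlab slab bd hseq.2 e01).
  move=> nus hnus; apply: ereal_sup_ubound; exists P, ni, nus; split => //.
    by split => //; exact: hseq.1.
  by rewrite PE.
have AeqB : model_measure_entropy V_gt0 sigma mu = B.
  by apply/eqP; rewrite eq_le AB BA.
by split=> //; rewrite AeqB; apply/eqP; rewrite eq_le BC CB.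
Qed.
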